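(* Let $\sigma^2 > 0$ and $0 < \beta < 1$ be fixed. Then for all $u \in \mathbb{R}$ and $v>0$, $$\lambda(u, v, \sigma^2, \beta) = u + \lambda(0, v, \sigma^2, \beta),$$ and this quantity is nondecreasing in $u \in \mathbb{R}$ (for each fixed $v$) and nondecreasing in $v \in (0,\infty)$ (for each fixed $u$).
   Context: For $u \in \mathbb{R}$, $v>0$, $\sigma^2>0$ and $0<\beta<1$, let $\theta$ be a random variable with prior distribution $\pi = N(u,v)$ (mean $u$, variance $v$) and, conditionally on $\theta$, let $X_1, X_2, \ldots$ be i.i.d. $N(\theta,\sigma^2)$ (the variance $\sigma^2$ is known). The Gittins index of this normal reward process is $$\lambda(u,v,\sigma^2,\beta) = \sup_{\xi \geq 1}\left[ E_\pi E_\theta\left(\sum_{n=1}^{\xi} \beta^{n-1} X_n\right) \bigg/ E_\pi E_\theta\left(\sum_{n=1}^{\xi} \beta^{n-1}\right)\right],$$ where the supremum is over all integer-valued stopping times $\xi \ge 1$ with respect to the filtration generated by $X_1, X_2, \ldots$. Here $E_\theta$ is the conditional expectation given $\theta$ and $E_\pi$ is the expectation over $\theta\sim\pi$, so $E_\pi E_\theta$ is the overall expectation. *)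

(* Defs.v *)
From HB Require Import structures.
From mathcomp Require Import all_boot all_order all_algebra.
From mathcomp Require Import all_classical all_reals all_analysis.
Import Order.TTheory GRing.Theory Num.Theory.
Import numFieldNormedType.Exports.

Set Implicit Arguments.
Unset Strict Implicit.
Unset Printing Implicit Defensive.

Local Open Scope classical_set_scope.
Local Open Scope ring_scope.
Local Open Scope ereal_scope.

(* A realisation, on some probability space, of the normal reward process with
   prior N(u, v) and known variance s2.  The rewards are numbered from 0: the
   mathematical X_1, X_2, ... are [reward 0], [reward 1], ...
   [reward_law] says that, given theta = t, the rewards are i.i.d. N(t, s2):
   the product of the N(t, s2) is a regular conditional distribution of the
   rewards given theta.  The second parameter of [normal_prob] is the standard
   deviation, whence the square roots. *)
Record normal_reward_process (R : realType) (u v s2 : R) := NormalRewardProcess {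
  display : measure_display ;
  Omega : measurableType display ;
  Pr : probability Omega R ;
  theta : {RV Pr >-> R} ;
  reward : nat -> {RV Pr >-> R} ;
  prior_law : forall A : set R, measurable A ->
    distribution Pr theta A = normal_prob u (Num.sqrt v) A ;
  reward_law : forall (n : nat) (A : set R) (B : nat -> set R),
    measurable A -> (forall i, measurable (B i)) ->
    Pr (theta @^-1` A `&` \bigcap_(i in `I_n) (reward i @^-1` B i)) =
    \int[distribution Pr theta]_(t in A)
      \prod_(0 <= i < n) normal_prob t (Num.sqrt s2) (B i)
}.

(* sigma(Y_0, ..., Y_(n-1)), that is, the information carried by the first n
   rewards. *)
Definition natural_filtration d (T : measurableType d) (R : realType)
    (Y : nat -> T -> R) (n : nat) : set (set T) :=
  g_sigma_preimage (fun i : 'I_n => Y i).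

Definition stopping_time d (T : measurableType d) (R : realType)
    (Y : nat -> T -> R) (xi : T -> nat) : Prop :=
  forall n, natural_filtration Y n [set w | (xi w <= n)%N].

Section gittins_index.
Context (R : realType) (u v s2 : R) (M : normal_reward_process u v s2).
Variable beta : R.

Definition discounted_reward (xi : Omega M -> nat) (w : Omega M) : R :=
  (\sum_(0 <= i < xi w) beta ^+ i * reward M i w)%R.

Definition discounted_time (xi : Omega M -> nat) (w : Omega M) : R :=
  (\sum_(0 <= i < xi w) beta ^+ i)%R.

Definition gittins_index : \bar R :=
  ereal_sup [set 'E_(Pr M)[discounted_reward xi] / 'E_(Pr M)[discounted_time xi]
            | xi in [set xi : Omega M -> nat |
                     (forall w, (1 <= xi w)%N) /\ stopping_time (reward M) xi]].

End gittins_index.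

(* Main.v *)
From HB Require Import structures.
Require Import Defs.
From mathcomp Require Import all_boot all_order all_algebra.
From mathcomp Require Import all_classical all_reals all_analysis.
From mathcomp Require Import measurable_realfun.
From mathcomp Require Import ring lra.
Import Order.TTheory GRing.Theory Num.Theory.
Import numFieldNormedType.Exports.

Set Implicit Arguments.
Unset Strict Implicit.
Unset Printing Implicit Defensive.

Local Open Scope classical_set_scope.
Local Open Scope ring_scope.
Local Open Scope ereal_scope.

(** The posterior of a normal prior under normal observations of known variance
    is normal, and its variance [var_after n] does not depend on what is
    observed. Only its mean [mean_after n] is random, and it is a Gaussian random
    walk with independent steps: [mean_transition]. The Gittins index is thus an
    optimal stopping problem for this walk, whose starting point is [u] and whose
    step variances increase with [v].

    The laws of two processes are never compared directly. Fix a charge [r] per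
    step and a horizon [k]. The optimal expected net reward is a function
    [value r k x m] of the prior variance [x] and mean [m], given by the Bellman
    recursion. For each process it bounds the net reward of every stopping time
    truncated at the horizon ([payoff_le_value]), and a stopping time attains it
    ([value_attained]). By dominated convergence truncation is harmless
    ([net_reward_limit]).

    The value functions compare by induction on the horizon ([le_value]). They
    are convex in the mean, a property kept by the positive part, by averaging
    over the next step and by the recursion. A convex function has a larger mean
    under a centred normal law of larger variance, because the latter is the sum
    of the former and an independent symmetric noise. As the steps of the walk
    have the larger variances when [v] is larger, so is the value. Adding [d] to
    both the mean and the charge leaves the value unchanged. Hence
    [le_gittins_index]: the index of [N(u, v)] plus [d] is at most the index of
    [N(u + d, v')] if [v <= v']. All three claims are instances of it.

    The random walk is obtained without conditional expectations. An event [E]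
    known after [n] rewards is kept fixed, and a law is said to be independent of
    such events when the product rule holds for all of them ([indep_law]). The
    noise, reward minus [theta], is independent of [theta] and of the past rewards
    ([noise_indep]). A rotation in the plane ([integral_gauss_rotation]) then
    performs one Bayesian update, and [posterior] iterates it. *)

(** * Densities, image measures and laws on events *)

(** [w] agrees almost everywhere with the Radon-Nikodym derivative of [rho], for
    which the change of variables is known. *)
Lemma integral_density d (T : measurableType d) (R : realType)
    (mu : {sigma_finite_measure set T -> \bar R})
    (rho : {finite_measure set T -> \bar R}) (w : T -> \bar R) :
  measurable_fun setT w -> (forall x, 0 <= w x) ->
  (forall A, measurable A -> rho A = \int[mu]_(x in A) w x) ->
  forall f : T -> \bar R, measurable_fun setT f -> (forall x, 0 <= f x) ->
  \int[rho]_x f x = \int[mu]_x (f x * w x).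
Proof.
move=> mw w0 rhoE f mf f0.
have iw : mu.-integrable setT w.
  apply/integrableP; split => //.
  under eq_integral do rewrite gee0_abs//.
  by rewrite -rhoE// ltey_eq fin_num_measure.
have rhomu : rho `<< mu.
  apply/null_content_dominatesP => A mA A0.
  by rewrite rhoE// null_set_integral//; exact: measurable_funTS.
rewrite -(Radon_Nikodym_SigmaFinite.change_of_variables rhomu)//.
apply: ae_eq_integral => //.
- apply: emeasurable_funM => //.
  exact: measurable_int (Radon_Nikodym_SigmaFinite.f_integrable rhomu).
- exact: emeasurable_funM.
- apply: ae_eqe_mul2l.
  apply: integral_ae_eq => //.
    exact: Radon_Nikodym_SigmaFinite.f_integrable.
  move=> A _ mA.
  by rewrite -Radon_Nikodym_SigmaFinite.f_integral// rhoE.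
Qed.

Section image_measure.
Context d d' (T : measurableType d) (T' : measurableType d') (R : realType).

(** The image measure bundled with the measurability of the map, so that it can
    be inferred to be a measure. *)
Definition image_measure (mu : {measure set T -> \bar R}) (X : T -> T')
    (mX : measurable_fun [set: T] X) : set T' -> \bar R :=
  fun A => mu (X @^-1` A).

Variables (mu : {measure set T -> \bar R}) (X : T -> T').
Hypothesis mX : measurable_fun [set: T] X.

Let image_measure0 : image_measure mu mX set0 = 0.
Proof. exact: measure0. Qed.

Let image_measure_ge0 A : 0 <= image_measure mu mX A.
Proof. exact: measure_ge0. Qed.

Let image_measure_sigma_additive : semi_sigma_additive (image_measure mu mX).
Proof.
pose Xm : {mfun T >-> T'} := HB.pack X (isMeasurableFun.Build _ _ _ _ X mX).
exact: (@measure_semi_sigma_additive _ _ _ (pushforward mu Xm)).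
Qed.

HB.instance Definition _ := isMeasure.Build _ _ _ (image_measure mu mX)
  image_measure0 image_measure_ge0 image_measure_sigma_additive.

Lemma integral_image_measure (f : T' -> \bar R) :
  measurable_fun [set: T'] f -> (forall y, 0 <= f y) ->
  \int[image_measure mu mX]_y f y = \int[mu]_x f (X x).
Proof. by move=> mf f0; rewrite -[RHS](ge0_integral_pushforward mX mu measurableT mf). Qed.

End image_measure.

Section law_on.
Context d d' (T : measurableType d) (T' : measurableType d') (R : realType).

Definition law_on (mu : {finite_measure set T -> \bar R}) (E : set T)
    (mE : measurable E) (X : T -> T') (mX : measurable_fun [set: T] X) :
  set T' -> \bar R := image_measure (mrestr mu mE) mX.

Variables (mu : {finite_measure set T -> \bar R}) (E : set T).
Hypothesis mE : measurable E.
Variable X : T -> T'.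
Hypothesis mX : measurable_fun [set: T] X.

HB.instance Definition _ := Measure.on (law_on mu mE mX).

Lemma law_onE A : law_on mu mE mX A = mu (E `&` X @^-1` A).
Proof. by rewrite setIC. Qed.

Let law_on_fin : fin_num_fun (law_on mu mE mX).
Proof.
move=> A mA; rewrite law_onE fin_num_measure//; apply: measurableI => //.
by rewrite -[X in measurable X]setTI; exact: mX.
Qed.

HB.instance Definition _ := @Measure_isFinite.Build _ _ _ (law_on mu mE mX)
  law_on_fin.

Lemma integral_law_on (f : T' -> \bar R) :
  measurable_fun [set: T'] f -> (forall y, 0 <= f y) ->
  \int[law_on mu mE mX]_y f y = \int[mu]_(x in E) f (X x).
Proof.
move=> mf f0; rewrite integral_image_measure// [RHS]integral_mkcond.
rewrite (integral_density (mu := mu) (w := fun x => (\1_E x)%:E))//.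
- apply: eq_integral => x _; rewrite patchE indicE.
  by case: ifPn; rewrite (mule1, mule0).
- exact/measurable_EFinP/measurable_indic.
- by move=> A mA; rewrite integral_indic// setIC.
- exact: measurableT_comp.
Qed.

End law_on.

(** * Centred normal laws *)

Section lebesgue_affine.
Context {R : realType}.
Local Notation mu := (@lebesgue_measure R).

(** Lebesgue measure is the only one giving intervals their lengths, and [k]
    times its image under [x |-> t + k * x] does so. *)
Lemma integral_lebesgue_affine (k t : R) (f : R -> \bar R) : (0 < k)%R ->
  measurable_fun setT f -> (forall x, 0 <= f x) ->
  \int[mu]_x f (t + k * x)%R = k^-1%:E * \int[mu]_x f x.
Proof.
move=> k0 mf f0.
pose phi : measurableTypeR R -> measurableTypeR R := fun x => (t + k * x)%R.
have mphi : measurable_fun setT phi.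
  by apply: measurable_funD => //; exact: measurable_funM.
have muE A : measurable A -> mu A = mscale (NngNum (ltW k0)) (image_measure mu mphi) A.
  move=> mA; apply: lebesgue_measure_unique => // _ [[a b]] _ <-.
  rewrite /mscale/=.
  transitivity (k%:E * mu (phi @^-1` [set` `]a, b]])) => //.
  have -> : phi @^-1` [set` `]a, b]] = [set` `](a - t) / k, (b - t) / k]%R].
    apply/seteqP; split => x; rewrite /phi /= !in_itv/=.
      by rewrite ltr_pdivrMr// ler_pdivlMr// => /andP[? ?]; lra.
    by rewrite ltr_pdivrMr// ler_pdivlMr// => /andP[? ?]; lra.
  rewrite !lebesgue_measure_itv/= !lte_fin ltr_pM2r ?invr_gt0// ltrD2r.
  case: ifPn => _; last by rewrite mule0.
  by rewrite -!EFinD -EFinM; congr EFin; field; rewrite gt_eqF.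
have -> : \int[mu]_x f x = k%:E * \int[mu]_x f (phi x).
  transitivity (\int[mscale (NngNum (ltW k0)) (image_measure mu mphi)]_x f x).
    by apply: eq_measure_integral => A mA _; exact: muE.
  by rewrite ge0_integral_mscale//= integral_image_measure.
by rewrite muleA -EFinM mulVf ?gt_eqF// mul1e.
Qed.

Lemma integral_lebesgueN (f : R -> \bar R) :
  measurable_fun setT f -> (forall x, 0 <= f x) ->
  \int[mu]_x f (- x)%R = \int[mu]_x f x.
Proof.
move=> mf f0.
pose phi : measurableTypeR R -> measurableTypeR R := -%R.
have mphi : measurable_fun setT phi by exact: oppr_measurable.
rewrite -[LHS](integral_image_measure mu mphi)//.
by apply: eq_measure_integral => A mA _; exact: lebesgue_measureN.
Qed.

Lemma measurable_normal_pdfE (m s : R) :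
  measurable_fun [set: R] (fun x => (normal_pdf m s x)%:E).
Proof. exact: measurable_int (integrable_normal_pdf m s). Qed.

Lemma integral_normal_pdfE (m s : R) (f : R -> \bar R) :
  measurable_fun setT f -> (forall x, 0 <= f x) ->
  \int[normal_prob m s]_x f x = \int[mu]_x (f x * (normal_pdf m s x)%:E).
Proof.
move=> mf f0; apply: integral_density => //.
  exact: measurable_normal_pdfE.
by move=> x; rewrite lee_fin normal_pdf_ge0.
Qed.

Lemma normal_pdf_affine (m k s x : R) : (0 < k)%R -> (0 < s)%R ->
  (normal_pdf m (k * s) (m + k * x) = k^-1 * normal_pdf 0 s x)%R.
Proof.
move=> k0 s0; rewrite !normal_pdfE ?mulf_eq0 ?negb_or ?gt_eqF//.
rewrite /normal_peak /normal_fun mulrA; congr (_ * expR _)%R; last first.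
  by field; rewrite !gt_eqF.
rewrite exprMn -mulrnAr -mulrA sqrtrM ?sqr_ge0// sqrtr_sqr gtr0_norm//.
by rewrite invfM mulrnAr.
Qed.

Lemma integral_normal_affine (m k s : R) (f : R -> \bar R) :
  (0 < k)%R -> (0 < s)%R ->
  measurable_fun setT f -> (forall x, 0 <= f x) ->
  \int[normal_prob m (k * s)]_x f x = \int[normal_prob 0 s]_x f (m + k * x)%R.
Proof.
move=> k0 s0 mf f0.
have mphi : measurable_fun setT (fun x : R => (m + k * x)%R).
  by apply: measurable_funD => //; exact: measurable_funM.
have mg : measurable_fun setT (fun x => f x * (normal_pdf m (k * s) x)%:E).
  by apply: emeasurable_funM => //; exact: measurable_normal_pdfE.
have g0 x : 0 <= f x * (normal_pdf m (k * s) x)%:E.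
  by rewrite mule_ge0// lee_fin normal_pdf_ge0.
apply: etrans (integral_normal_pdfE m (k * s) mf f0) _.
apply/esym; apply: etrans (integral_normal_pdfE 0 s (measurableT_comp mf mphi) _) _.
  by move=> x /=.
apply/esym; pose h x := f (m + k * x)%R * (normal_pdf 0 s x)%:E.
have mh : measurable_fun setT h.
  apply: emeasurable_funM; first exact: (measurableT_comp mf).
  exact: measurable_normal_pdfE.
have h0 x : [set: R] x -> 0 <= h x.
  by move=> _; rewrite mule_ge0// lee_fin normal_pdf_ge0.
have k'0 : 0 <= k^-1%:E by rewrite lee_fin invr_ge0 ltW.
have := integral_lebesgue_affine m k0 mg g0.
have -> : \int[mu]_x (f (m + k * x)%R * (normal_pdf m (k * s) (m + k * x))%:E) =
    \int[mu]_x (k^-1%:E * h x).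
  by apply: eq_integral => x _; rewrite /h normal_pdf_affine// EFinM muleCA.
have -> : \int[mu]_x (k^-1%:E * h x) = k^-1%:E * \int[mu]_x h x.
  by apply: ge0_integralZl.
have kk : k%:E * k^-1%:E = 1 :> \bar R by rewrite -EFinM mulfV ?gt_eqF.
have inj : injective (mule k^-1%:E : \bar R -> \bar R).
  by move=> a b /(congr1 (mule k%:E)); rewrite !muleA kk !mul1e.
by move=> /inj ->.
Qed.

End lebesgue_affine.

Section gauss.
Context {R : realType}.
Local Notation mu := (@lebesgue_measure R).

Let measurable_idR : measurable_fun [set: measurableTypeR R] (id : _ -> R).
Proof. by move=> _ A mA; rewrite setTI. Qed.

(** The image under the identity carries the law from the Borel structure
    generated by the half-open intervals to the default one of [R]. *)
Definition normal_image (v : R) : set R -> \bar R :=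
  image_measure (normal_prob 0 (Num.sqrt v)) measurable_idR.

HB.instance Definition _ v := Measure.on (normal_image v).

Let normal_image_setT v : normal_image v [set: R] = 1.
Proof. exact: probability_setT. Qed.

HB.instance Definition _ v :=
  Measure_isProbability.Build _ _ _ (normal_image v) (normal_image_setT v).

Fact gauss_subproof v :
  {P : probability R R | P = normal_image v :> probability R R}.
Proof. by exists (normal_image v). Qed.

(** The centred normal law of variance [v], sealed so that conversion never
    compares the densities of two such laws. *)
Definition gauss (v : R) : probability R R := sval (gauss_subproof v).

Lemma integral_gaussE v (f : R -> \bar R) :
  measurable_fun [set: R] f -> (forall x, 0 <= f x) ->
  \int[gauss v]_x f x = \int[normal_prob 0 (Num.sqrt v)]_x f x.
Proof.
by move=> mf f0; rewrite /gauss (svalP (gauss_subproof v)) integral_image_measure.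
Qed.

Section integral_gauss.
Variables (v : R) (f : R -> \bar R).
Hypotheses (v0 : (0 < v)%R) (mf : measurable_fun [set: R] f).
Hypothesis f0 : forall x, 0 <= f x.

Lemma integral_gauss_pdf :
  \int[gauss v]_x f x = \int[mu]_x (f x * (normal_pdf 0 (Num.sqrt v) x)%:E).
Proof. by rewrite integral_gaussE//; exact: integral_normal_pdfE. Qed.

Lemma integral_normal_gauss m :
  \int[normal_prob m (Num.sqrt v)]_x f x = \int[gauss v]_x f (m + x)%R.
Proof.
have sv0 : (0 < Num.sqrt v)%R by rewrite sqrtr_gt0.
rewrite -[in LHS](mul1r (Num.sqrt v)).
apply: etrans (integral_normal_affine m ltr01 sv0 mf f0) _.
rewrite integral_gaussE//; last first.
  by apply: (measurableT_comp mf); exact: measurable_funD.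
by apply: eq_integral => x _; rewrite mul1r.
Qed.

Lemma integral_gauss_scale k : (0 < k)%R ->
  \int[gauss (k ^+ 2 * v)]_x f x = \int[gauss v]_x f (k * x)%R.
Proof.
move=> k0; have sv0 : (0 < Num.sqrt v)%R by rewrite sqrtr_gt0.
have sE : (Num.sqrt (k ^+ 2 * v) = k * Num.sqrt v)%R.
  by rewrite sqrtrM ?sqr_ge0// sqrtr_sqr gtr0_norm.
rewrite [RHS]integral_gaussE//; last first.
  by apply: (measurableT_comp mf); exact: measurable_funM.
apply: etrans (integral_gaussE _ mf f0) _.
rewrite sE.
apply: etrans (integral_normal_affine 0 k0 sv0 mf f0) _.
by apply: eq_integral => x _; rewrite add0r.
Qed.

Lemma integral_gaussN : \int[gauss v]_x f (- x)%R = \int[gauss v]_x f x.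
Proof.
have mfN : measurable_fun [set: R] (fun x => f (- x)%R).
  exact: (measurableT_comp mf (@oppr_measurable R setT)).
have f0N x : 0 <= f (- x)%R by [].
apply: etrans (integral_gaussE _ mfN f0N) _.
apply: etrans (integral_normal_pdfE 0 _ mfN f0N) _.
apply/esym; apply: etrans integral_gauss_pdf _.
apply: etrans (esym (integral_lebesgueN _ _)) _.
- by apply: emeasurable_funM => //; exact: measurable_normal_pdfE.
- by move=> x; rewrite mule_ge0// lee_fin normal_pdf_ge0.
- apply: eq_integral => x _; congr (_ * _%:E).
  rewrite !normal_pdfE ?gt_eqF ?sqrtr_gt0// /normal_fun; congr (_ * expR _)%R.
  by rewrite !subr0 sqrrN.
Qed.

End integral_gauss.

(** The density times [|x|] is at most a multiple of the density with twice the
    standard deviation. *)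
Lemma gauss_abs_moment_lty (v : R) : (0 < v)%R ->
  \int[gauss v]_x `|x|%:E < +oo.
Proof.
move=> v0; have mabs : measurable_fun [set: R] (fun x : R => `|x|%:E).
  by apply/measurable_EFinP; exact: normr_measurable.
rewrite (integral_gauss_pdf _ mabs)//.
set s := Num.sqrt v; have s0 : (0 < s)%R by rewrite sqrtr_gt0.
have c0 : 0 <= (2 * s)%:E by rewrite lee_fin mulr_ge0// ltW.
have p0 x : 0 <= (normal_pdf 0 (2 * s) x)%:E by rewrite lee_fin normal_pdf_ge0.
have mp := measurable_normal_pdfE 0 (2 * s)%R.
apply: (@le_lt_trans _ _
    (\int[mu]_x ((2 * s)%:E * (normal_pdf 0 (2 * s) x)%:E))); last first.
  have -> : \int[mu]_x ((2 * s)%:E * (normal_pdf 0 (2 * s) x)%:E) =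
      (2 * s)%:E * \int[mu]_x (normal_pdf 0 (2 * s) x)%:E.
    by apply: ge0_integralZl.
  by rewrite (integral_normal_pdf 0 (2 * s)%R) mule1 ltry.
apply: ge0_le_integral => //.
- by move=> x _; rewrite mule_ge0// lee_fin normal_pdf_ge0.
- by apply: emeasurable_funM => //; exact: measurable_normal_pdfE.
- exact: (measurable_funeM _ mp).
move=> x _; rewrite -!EFinM lee_fin !normal_pdfE ?mulf_neq0 ?gt_eqF//.
have -> : (normal_peak (2 * s) = 2^-1 * normal_peak s)%R.
  rewrite /normal_peak exprMn -mulrnAr -mulrA (@sqrtrM _ (2 ^+ 2))//.
  by rewrite sqrtr_sqr ger0_norm// invfM mulrnAr.
set p := normal_peak s; have pge0 : (0 <= p)%R := normal_peak_ge0 s.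
rewrite /normal_fun.
set a := (- (x - 0) ^+ 2 / (_ *+ 2))%R.
set b := (- (x - 0) ^+ 2 / _)%R.
(* 1 + y <= e^y at y = 3 z^2 / 8 dominates z *)
have xab : (`|x| <= s * expR (b - a))%R.
  have := expR_ge1Dx (b - a); set z := (`|x| / s)%R.
  have -> : `|x|%R = (s * z)%R by rewrite /z mulrCA mulfV ?mulr1// gt_eqF.
  have -> : (b - a = 3 / 8 * z ^+ 2)%R.
    rewrite /a /b /z expr_div_n real_normK ?num_real//; field.
    by rewrite gt_eqF.
  move=> h; rewrite ler_pM2l//; apply: le_trans h.
  by have := sqr_ge0 (z - 4 / 3)%R; nra.
have eab : expR b = (expR (b - a) * expR a)%R by rewrite -expRD subrK.
have := expR_gt0 a => ea.
rewrite eab.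
have -> : (2 * s * (2^-1 * p * (expR (b - a) * expR a)) =
  (s * expR (b - a)) * (p * expR a))%R by field.
by rewrite ler_wpM2r// mulr_ge0// ltW.
Qed.

(** The quadratic form [d^2 / v + e^2 / s2] is diagonal in the coordinates
    [x = d + e] (the innovation) and [y = d - v / (v + s2) * x] (the posterior
    deviation). *)
Lemma normal_pdf_rotation (v s2 x y : R) : (0 < v)%R -> (0 < s2)%R ->
  (normal_pdf 0 (Num.sqrt v) (y + v / (v + s2) * x) *
   normal_pdf 0 (Num.sqrt s2) (x - (y + v / (v + s2) * x)) =
   normal_pdf 0 (Num.sqrt (v + s2)) x *
   normal_pdf 0 (Num.sqrt (v * s2 / (v + s2))) y)%R.
Proof.
move=> v0 s0; have vs0 : (0 < v + s2)%R by rewrite addr_gt0.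
have p0 : (0 < v * s2 / (v + s2))%R by rewrite divr_gt0// mulr_gt0.
rewrite !normal_pdfE ?gt_eqF ?sqrtr_gt0//.
rewrite /normal_peak /normal_fun !sqr_sqrtr ?(ltW v0, ltW s0, ltW vs0, ltW p0)//.
rewrite mulrACA [RHS]mulrACA -!invfM -!expRD -!sqrtrM; last 2 first.
- by rewrite mulrn_wge0// mulr_ge0 ?pi_ge0// ltW.
- by rewrite mulrn_wge0// mulr_ge0 ?pi_ge0// ltW.
congr ((Num.sqrt _)^-1 * expR _)%R.
  by field; rewrite gt_eqF.
by field; rewrite !gt_eqF.
Qed.

Lemma integral_lebesgue_shift (t : R) (f : R -> \bar R) :
  measurable_fun setT f -> (forall x, 0 <= f x) ->
  \int[mu]_x f (t + x)%R = \int[mu]_x f x.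
Proof.
move=> mf f0; have := integral_lebesgue_affine t ltr01 mf f0.
rewrite invr1 mul1e => <-.
by apply: eq_integral => x _; rewrite mul1r.
Qed.

Lemma measurable_integral_snd (nu : probability R R) (f : R * R -> \bar R) :
  measurable_fun [set: R * R] f -> (forall z, 0 <= f z) ->
  measurable_fun [set: R] (fun x => \int[nu]_y f (x, y)).
Proof. by move=> mf f0; exact: measurable_fun_fubini_tonelli_F. Qed.

(** Bayes' formula for one observation. The prior deviation [d] and the noise
    [e] are replaced by the innovation [d + e] and the posterior deviation. This
    linear map is a product of two shears, each absorbed by the translation
    invariance of Lebesgue measure in one variable, and [normal_pdf_rotation]
    shows that the new coordinates are independent again. *)
Lemma integral_gauss_rotation (v s2 : R) (f : R * R -> \bar R) :
  (0 < v)%R -> (0 < s2)%R ->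
  measurable_fun [set: R * R] f -> (forall z, 0 <= f z) ->
  \int[gauss v]_d \int[gauss s2]_e
    f (d + e, d - v / (v + s2) * (d + e))%R =
  \int[gauss (v + s2)]_x \int[gauss (v * s2 / (v + s2))]_y f (x, y).
Proof.
move=> v0 s0 mf f0; have vs0 : (0 < v + s2)%R by rewrite addr_gt0.
have pv0 : (0 < v * s2 / (v + s2))%R by rewrite divr_gt0// mulr_gt0.
set k := (v / (v + s2))%R.
pose p w x : \bar R := (normal_pdf 0 (Num.sqrt w) x)%:E.
have mp w : measurable_fun [set: R] (p w) by exact: measurable_normal_pdfE.
have p0 w x : 0 <= p w x by rewrite lee_fin normal_pdf_ge0.
have mfst : measurable_fun [set: R * R] (fst : R * R -> R) by [].
have msnd : measurable_fun [set: R * R] (snd : R * R -> R) by [].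
pose F z := f (z.2, z.1 - k * z.2)%R * p s2 (z.2 - z.1)%R * p v z.1.
have mF : measurable_fun [set: R * R] F.
  apply: emeasurable_funM; last exact: (measurableT_comp (mp v) mfst).
  apply: emeasurable_funM.
    apply: (measurableT_comp mf); apply: measurable_fun_pair => //.
    by apply: measurable_funB => //; exact: measurable_funM.
  by apply: (measurableT_comp (mp s2)); exact: measurable_funB.
have F0 z : 0 <= F z by rewrite /F !mule_ge0.
have mpair (x : R) : measurable_fun [set: R] (fun y : R => (x, y)).
  exact: measurable_fun_pair.
transitivity (\int[mu]_d \int[mu]_x F (d, x)).
  pose h (z : R * R) := f (z.1 + z.2, z.1 - k * (z.1 + z.2))%R.
  have mh : measurable_fun [set: R * R] h.
    have md : measurable_fun [set: R * R] (fun z : R * R => z.1 + z.2)%R.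
      exact: measurable_funD.
    apply: (measurableT_comp mf); apply: measurable_fun_pair => //.
    by apply: measurable_funB => //; exact: measurable_funM.
  have h0 z : 0 <= h z by exact: f0.
  have mI := measurable_integral_snd (gauss s2) mh h0.
  have I0 x : 0 <= \int[gauss s2]_y h (x, y) by exact: integral_ge0.
  apply: etrans (integral_gauss_pdf v mI I0) _.
  apply: eq_integral => d _.
  have mhd : measurable_fun [set: R] (fun e => h (d, e)).
    exact: (measurableT_comp mh (mpair d)).
  have hd0 e : 0 <= h (d, e) by exact: f0.
  rewrite (integral_gauss_pdf s2 mhd hd0).
  pose g (x : R) := f (x, d - k * x)%R * p s2 (x - d)%R.
  have mg : measurable_fun [set: R] g.
    apply: emeasurable_funM.
      apply: (measurableT_comp mf); apply: measurable_fun_pair => //.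
      by apply: measurable_funB => //; exact: measurable_funM.
    by apply: (measurableT_comp (mp s2)); exact: measurable_funB.
  have g0 x : 0 <= g x by exact: mule_ge0.
  have -> : \int[mu]_x (h (d, x) * (normal_pdf 0 (Num.sqrt s2) x)%:E) =
      \int[mu]_x g x.
    apply: etrans (integral_lebesgue_shift d mg g0).
    by apply: eq_integral => x _; rewrite /g (addrC (d + x)%R (- d)%R) addKr.
  exact: esym (ge0_integralZr mu measurableT mg (fun x _ => g0 x) (p0 v d)).
transitivity (\int[mu]_x \int[mu]_d F (d, x)).
  exact: (@fubini_tonelli _ _ _ _ _ mu mu F mF F0).
have mI := measurable_integral_snd (gauss (v * s2 / (v + s2))) mf f0.
have I0 x : 0 <= \int[gauss (v * s2 / (v + s2))]_y f (x, y).
  exact: integral_ge0.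
apply/esym; apply: etrans (integral_gauss_pdf (v + s2) mI I0) _.
apply: eq_integral => x _.
have mfx : measurable_fun [set: R] (fun y => f (x, y)).
  exact: (measurableT_comp mf (mpair x)).
have fx0 y : 0 <= f (x, y) by exact: f0.
rewrite (integral_gauss_pdf _ mfx fx0).
have mFx : measurable_fun [set: R] (fun d => F (d, x)).
  exact: (measurableT_comp mF (measurable_fun_pair _ _)).
rewrite -[RHS](integral_lebesgue_shift (k * x) mFx (fun d => F0 (d, x))).
have mfp : measurable_fun [set: R] (fun y => f (x, y) * p (v * s2 / (v + s2))%R y).
  exact: emeasurable_funM.
have fp0 (y : R) : [set: R] y -> 0 <= f (x, y) * p (v * s2 / (v + s2))%R y.
  by move=> _; exact: mule_ge0.
apply: etrans (esym (ge0_integralZr mu measurableT mfp fp0 (p0 (v + s2)%R x))) _.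
apply: eq_integral => y _; rewrite /F /= (addrC (k * x)%R y) addrK.
rewrite -!muleA; congr (_ * _); rewrite /p -!EFinM; congr EFin.
by rewrite mulrC -normal_pdf_rotation// mulrC.
Qed.

End gauss.

(** * Laws independent of a family of events *)

Section independence.
Context d (T : measurableType d) (R : realType) (P : probability T R).

(** The event [E = setT] gives the law of [Y], the other ones its independence
    of [F]. *)
Definition indep_law (F : set (set T)) (Y : T -> R) (nu : set R -> \bar R) :=
  forall E B, F E -> measurable B -> P (E `&` Y @^-1` B) = P E * nu B.

(** Both sides of the product rule are finite measures in the event, so that
    agreement on a generating pi-system is enough. *)
Lemma indep_law_sigma (G : set (set T)) (Y : T -> R) (nu : probability R R) :
  G `<=` measurable -> setI_closed G -> G [set: T] ->
  measurable_fun [set: T] Y ->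
  indep_law G Y nu -> indep_law <<s G >> Y nu.
Proof.
move=> Gm GI GT mY YG E B GE mB.
have mYB : measurable (Y @^-1` B) by rewrite -[X in measurable X]setTI; exact: mY.
have nuB : (0 <= fine (nu B))%R by rewrite fine_ge0.
have fB : (fine (nu B))%:E = nu B by rewrite fineK ?fin_num_measure.
have msE A : mscale (NngNum nuB) P A = P A * nu B by rewrite /mscale/= fB muleC.
rewrite -msE -[LHS]/(mrestr P mYB E).
apply: (@g_sigma_algebra_measure_unique _ _ _ G Gm (fun=> setT)) => //.
- by rewrite bigcup_const//; exists 0%N.
- by move=> A GA; apply: etrans (esym (msE A)); exact: YG.
- by move=> _; rewrite ltey_eq fin_num_measure.
Qed.

(** On [E] the pair has a product law, by uniqueness of product measures; Tonelli
    then integrates out the second component. *)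
Lemma integral_indep (E : set T) (X Y : T -> R) (nu : probability R R)
    (f : R * R -> \bar R) :
  measurable E -> measurable_fun [set: T] X -> measurable_fun [set: T] Y ->
  (forall A B, measurable A -> measurable B ->
    P (E `&` X @^-1` A `&` Y @^-1` B) = P (E `&` X @^-1` A) * nu B) ->
  measurable_fun [set: R * R] f -> (forall z, 0 <= f z) ->
  \int[P]_(w in E) f (X w, Y w) = \int[P]_(w in E) \int[nu]_y f (X w, y).
Proof.
move=> mE mX mY XY mf f0.
have mXY : measurable_fun [set: T] (fun w => (X w, Y w)).
  exact: measurable_fun_pair.
rewrite -(integral_law_on P mE mXY mf f0).
have mI := measurable_integral_snd nu mf f0.
have I0 x : 0 <= \int[nu]_y f (x, y) by exact: integral_ge0.
rewrite -(integral_law_on P mE mX mI I0).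
rewrite -(@fubini_tonelli1 _ _ _ _ _ (law_on P mE mX) nu f mf f0).
apply: eq_measure_integral => A mA _; apply/esym/product_measure_unique => //.
move=> B C mB mC; apply: etrans (law_onE P mE mXY _) _.
apply: etrans (_ : _ = P (E `&` X @^-1` B) * nu C) _.
  by rewrite -XY//; congr (P _); rewrite -setIA.
by congr (_ * _); exact: esym (law_onE P mE mX B).
Qed.

Lemma indep_law_sub (F G : set (set T)) (Y : T -> R) nu :
  F `<=` G -> indep_law G Y nu -> indep_law F Y nu.
Proof. by move=> FG YG E B FE mB; apply: YG => //; exact: FG. Qed.

Lemma integral_indep_law (F : set (set T)) (Y : T -> R) (nu : probability R R)
    (E : set T) (g : R -> \bar R) :
  measurable_fun [set: T] Y -> indep_law F Y nu ->
  F E -> measurable E ->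
  measurable_fun [set: R] g -> (forall x, 0 <= g x) ->
  \int[P]_(w in E) g (Y w) = P E * \int[nu]_x g x.
Proof.
move=> mY YF FE mE mg g0; rewrite -(integral_law_on P mE mY mg g0).
have pE : (0 <= fine (P E))%R by rewrite fine_ge0.
pose k := NngNum pE; have kE : P E = k%:num%:E by rewrite fineK ?fin_num_measure.
transitivity (\int[mscale k nu]_x g x).
  apply: eq_measure_integral => A mA _; apply: etrans (law_onE P mE mY A) _.
  by apply: etrans (YF _ _ FE mA) _; rewrite kE.
by rewrite ge0_integral_mscale// kE.
Qed.

Lemma measurable_fun_sub_sigma (G H : set (set T)) (f : T -> R) :
  <<s G >> `<=` <<s H >> ->
  measurable_fun [set: g_sigma_algebraType G] (f : g_sigma_algebraType G -> R) ->
  measurable_fun [set: g_sigma_algebraType H] (f : g_sigma_algebraType H -> R).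
Proof. by move=> GH mf _ B mB; apply: GH; exact: mf. Qed.

Lemma preimage_sigma (G : set (set T)) (f : T -> R) (B : set R) :
  measurable_fun [set: g_sigma_algebraType G] (f : g_sigma_algebraType G -> R) ->
  measurable B -> <<s G >> (f @^-1` B).
Proof. by move=> mf mB; rewrite -[X in <<s G >> X]setTI; exact: mf. Qed.

Lemma setI_sigma (G : set (set T)) (A B : set T) :
  <<s G >> A -> <<s G >> B -> <<s G >> (A `&` B).
Proof. exact: (@measurableI _ (g_sigma_algebraType G)). Qed.

End independence.

Lemma eq_measure_rectangle d1 d2 (T1 : measurableType d1)
    (T2 : measurableType d2) (R : realType)
    (m1 : {finite_measure set (T1 * T2)%type -> \bar R})
    (m2 : {measure set (T1 * T2)%type -> \bar R}) :
  (forall A B, measurable A -> measurable B -> m1 (A `*` B) = m2 (A `*` B)) ->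
  forall X, measurable X -> m1 X = m2 X.
Proof.
move=> m12; pose G : set (set (T1 * T2)%type) :=
  [set A `*` B | A in measurable & B in measurable].
apply: (measure_unique G (fun=> setT)).
- by rewrite measurable_prod_measurableType.
- move=> _ _ [A mA [B mB <-]] [A' mA' [B' mB' <-]].
  exists (A `&` A'); first exact: measurableI.
  by exists (B `&` B'); [exact: measurableI|rewrite setXI].
- by move=> _; exists setT => //; exists setT => //; rewrite setXTT.
- by rewrite bigcup_const//; exists 0%N.
- by move=> _ [A mA [B mB <-]]; exact: m12.
- by move=> _; rewrite ltey_eq fin_num_measure.
Qed.

(** * The noise of the rewards *)

Section normal_kernel.
Context {R : realType} (s : R).
Hypothesis s0 : (0 < s)%R.

Lemma normal_prob_shift (t : R) (C : set R) : measurable C ->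
  normal_prob t (Num.sqrt s) C = \int[gauss s]_e (\1_C (t + e))%:E.
Proof.
move=> mC.
have mI : measurable_fun [set: R] (fun x : R => (\1_C x)%:E : \bar R).
  exact/measurable_EFinP/measurable_indic.
have I0 x : 0 <= (\1_C x)%:E :> \bar R by rewrite lee_fin.
rewrite -(integral_normal_gauss s0 mI I0).
by rewrite integral_indic// setIT.
Qed.

Let measurable_shift_indic (C : set R) : measurable C ->
  measurable_fun [set: R * R] (fun z : R * R => (\1_C (z.1 + z.2)%R)%:E : \bar R).
Proof.
move=> mC; have md : measurable_fun [set: R * R] (fun z : R * R => z.1 + z.2)%R.
  exact: measurable_funD.
by apply/measurable_EFinP; apply: measurableT_comp md; exact: measurable_indic.
Qed.

Lemma measurable_normal_prob (C : set R) : measurable C ->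
  measurable_fun [set: R] (fun t => normal_prob t (Num.sqrt s) C).
Proof.
move=> mC; have z0 (z : R * R) : 0 <= (\1_C (z.1 + z.2)%R)%:E :> \bar R.
  by rewrite lee_fin.
have := measurable_integral_snd (gauss s) (measurable_shift_indic mC) z0.
by apply: eq_measurable_fun => t _; rewrite normal_prob_shift.
Qed.

(** The normal law of mean [t] is the translate by [t] of the centred one, so
    [rho1] is the image of a product measure under the shear
    [(t, e) |-> (t, t + e)], which the difference of the coordinates undoes. *)
Lemma normal_kernel_noise (rho : {finite_measure set R -> \bar R})
    (rho1 : {finite_measure set (R * R)%type -> \bar R}) :
  (forall A C : set R, measurable A -> measurable C ->
    rho1 (A `*` C) = \int[rho]_(t in A) normal_prob t (Num.sqrt s) C) ->
  forall A C : set R, measurable A -> measurable C ->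
    rho1 [set z : R * R | A z.1 /\ C (z.2 - z.1)%R] = rho A * gauss s C.
Proof.
move=> rho1E A C mA mC.
pose phi (z : R * R) : R * R := (z.1, z.1 + z.2)%R.
have mphi : measurable_fun [set: R * R] phi.
  by apply: measurable_fun_pair => //; exact: measurable_funD.
have rhoE X : measurable X ->
    rho1 X = image_measure (product_measure1 rho (gauss s)) mphi X.
  apply: eq_measure_rectangle => {A C mA mC X} A C mA mC; rewrite rho1E//.
  have mX : measurable (A `*` C) by exact: measurableX.
  transitivity (\int[rho]_t \int[gauss s]_e (\1_(A `*` C) (phi (t, e)))%:E).
    rewrite integral_mkcond; apply: eq_integral => t _; rewrite patchE.
    case: ifPn => tA.
      rewrite normal_prob_shift//; apply: eq_integral => e _; congr (_%:E).
      rewrite !indicE; congr (_%:R); congr nat_of_bool.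
      by apply/idP/idP; rewrite !inE /phi /=; [move=> ?; split => //; exact/set_mem|case].
    rewrite integral0_eq// => e _; rewrite indicE /phi/= memNset// => -[/= tA' _].
    by move: tA; rewrite notin_setE.
  have mI : measurable_fun [set: R * R]
      (fun z : R * R => (\1_(A `*` C) (phi z))%:E : \bar R).
    by apply/measurable_EFinP; apply: measurableT_comp mphi; exact: measurable_indic.
  have I0 z : 0 <= (\1_(A `*` C) (phi z))%:E :> \bar R by rewrite lee_fin.
  rewrite -(@fubini_tonelli1 _ _ _ _ _ rho (gauss s) _ mI I0).
  rewrite -(integral_image_measure (product_measure1 rho (gauss s)) mphi
    (f := fun z => (\1_(A `*` C) z)%:E)).
  - by rewrite integral_indic// setIT.
  - exact/measurable_EFinP/measurable_indic.
  - by move=> z; rewrite lee_fin.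
rewrite rhoE; last first.
  have mB : measurable_fun [set: R * R] (fun z : R * R => z.2 - z.1)%R.
    exact: measurable_funB.
  rewrite (_ : [set z | _] = (setT `&` fst @^-1` A) `&`
      (setT `&` (fun z : R * R => z.2 - z.1)%R @^-1` C)).
    by apply: measurableI; [exact: measurable_fst|exact: mB].
  by rewrite !setTI.
rewrite /image_measure -product_measure1E//; congr (product_measure1 _ _ _).
apply/seteqP; split => -[t e] /=; rewrite /phi/=.
  by rewrite addrC addKr.
by rewrite addrC addKr.
Qed.

End normal_kernel.

Section noise.
Context (R : realType) (u v s2 : R) (M : normal_reward_process u v s2).
Hypotheses (v0 : (0 < v)%R) (s0 : (0 < s2)%R).
Local Notation P := (Pr M).
Local Notation th := (theta M).
Local Notation Y := (reward M).

Lemma measurable_theta : measurable_fun [set: Omega M] (th : Omega M -> R).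
Proof. exact: measurable_funPT. Qed.

Lemma measurable_reward n : measurable_fun [set: Omega M] (Y n : Omega M -> R).
Proof. exact: measurable_funPT. Qed.

(** A pi-system generating the information carried by [theta] and the first [n]
    rewards, on which [reward_law] speaks directly. *)
Definition theta_reward_cylinders n : set (set (Omega M)) :=
  [set G | exists A B, [/\ measurable A, (forall i, measurable (B i)) &
    G = th @^-1` A `&` \bigcap_(i in `I_n) (Y i @^-1` B i)]].

Let measurable_bigcap_reward n (B : nat -> set R) :
  (forall i, measurable (B i)) ->
  measurable (\bigcap_(i in `I_n) (Y i @^-1` B i)).
Proof.
move=> mB; rewrite bigcap_mkord; apply: bigsetI_measurable => i _.
by rewrite -[X in measurable X]setTI; exact: measurable_reward.
Qed.

Let measurable_likelihood n (B : nat -> set R) : (forall i, measurable (B i)) ->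
  measurable_fun [set: R]
    (fun t => \prod_(0 <= i < n) normal_prob t (Num.sqrt s2) (B i)).
Proof.
move=> mB; elim: n => [|n IH].
  by under eq_fun do rewrite big_geq//; exact: measurable_cst.
under eq_fun do rewrite big_nat_recr//=.
by apply: emeasurable_funM => //; exact: measurable_normal_prob.
Qed.

(** On the cylinder cut out by the first [n] rewards, [theta] has the likelihood
    [w] of these rewards as density with respect to the prior, and the law of the
    pair of [theta] and the next reward is [normal_prob theta] integrated against
    it. *)
Lemma noise_cylinder n :
  indep_law P (theta_reward_cylinders n) (fun w => Y n w - th w)%R (gauss s2).
Proof.
move=> _ C [A [B [mA mB ->]]] mC.
set E := \bigcap_(i in _) _.
have mE : measurable E by exact: measurable_bigcap_reward.
have mpair : measurable_fun [set: Omega M] (fun w => (th w, Y n w)).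
  by apply: measurable_fun_pair; [exact: measurable_theta|exact: measurable_reward].
pose w t := \prod_(0 <= i < n) normal_prob t (Num.sqrt s2) (B i).
have w0 t : 0 <= w t by apply: prode_ge0 => i _; exact: measure_ge0.
have mw : measurable_fun [set: R] w by exact: measurable_likelihood.
have rhoE A' : measurable A' ->
    law_on P mE measurable_theta A' = \int[distribution P th]_(t in A') w t.
  by move=> mA'; apply: etrans (law_onE _ _ _ _) _; rewrite setIC; exact: reward_law.
have K0 t C' : measurable C' -> 0 <= normal_prob t (Num.sqrt s2) C'.
  by move=> mC'; exact: measure_ge0.
have key A' C' : measurable A' -> measurable C' ->
    law_on P mE mpair (A' `*` C') =
    \int[law_on P mE measurable_theta]_(t in A') normal_prob t (Num.sqrt s2) C'.
  move=> mA' mC'; apply: etrans (law_onE P mE mpair _) _.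
  pose B' i := if (i < n)%N then B i else C'.
  have mB' i : measurable (B' i) by rewrite /B'; case: ifP.
  rewrite (_ : _ `&` _ = th @^-1` A' `&` \bigcap_(i in `I_n.+1) (Y i @^-1` B' i)).
    apply: etrans (reward_law M n.+1 mA' mB') _; rewrite [RHS]integral_mkcond.
    rewrite (integral_density mw w0 rhoE)//.
    - rewrite [LHS]integral_mkcond; apply: eq_integral => t _; rewrite !patchE.
      case: ifPn => _; last by rewrite mul0e.
      rewrite big_nat_recr//= {2}/B' ltnn muleC; congr (_ * _).
      by apply: eq_big_nat => i /andP[_ ni]; rewrite /B' ni.
    - apply/(measurable_restrictT _ mA').
      apply: measurable_funTS; exact: measurable_normal_prob.
    - by move=> t; apply: erestrict_ge0 => t' _; exact: K0 mC'.
  apply/seteqP; split => [w' [Ew [/= Aw Cw]]|w' [Aw Bw]].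
    split => // i /=; rewrite ltnS leq_eqVlt => /predU1P[->|ni].
      by rewrite /B' ltnn.
    by rewrite /B' ni; exact: Ew.
  split => [i/= ni|].
    by have := Bw i (ltnW ni); rewrite /B' ni.
  split => //=; have := Bw n (ltnSn n); by rewrite /B' ltnn.
apply: etrans (etrans (_ : _ = law_on P mE mpair _)
  (normal_kernel_noise s0 key mA mC)) _.
  by apply/esym/(etrans (law_onE P mE mpair _)); rewrite setICA setIA.
by congr (_ * _); apply: etrans (law_onE P mE _ _) _; rewrite setIC.
Qed.

Lemma theta_reward_cylinders_measurable n :
  theta_reward_cylinders n `<=` measurable.
Proof.
move=> _ [A [B [mA mB ->]]]; apply: measurableI => //.
  by rewrite -[X in measurable X]setTI; exact: measurable_theta.
exact: measurable_bigcap_reward.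
Qed.

Lemma noise_indep n :
  indep_law P <<s theta_reward_cylinders n >> (fun w => Y n w - th w)%R
    (gauss s2).
Proof.
apply: indep_law_sigma; last exact: noise_cylinder.
- exact: theta_reward_cylinders_measurable.
- move=> _ _ [A [B [mA mB ->]]] [A' [B' [mA' mB' ->]]].
  exists (A `&` A'), (fun i => B i `&` B' i); split.
  + exact: measurableI.
  + by move=> i; exact: measurableI.
  + by rewrite setIACA -bigcapI.
- exists setT, (fun=> setT); split => //.
  by rewrite preimage_setT setTI; apply/esym; rewrite -subTset => w _ i _.
- by apply: measurable_funB; [exact: measurable_reward|exact: measurable_theta].
Qed.

End noise.

(** * The posterior law and the random walk of its mean *)

Section posterior.
Context (R : realType) (u v s2 : R) (M : normal_reward_process u v s2).
Hypotheses (v0 : (0 < v)%R) (s0 : (0 < s2)%R).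
Local Notation P := (Pr M).
Local Notation th := (theta M).
Local Notation Y := (reward M).
Local Notation F n := (natural_filtration Y n).

(** Variance of the posterior of a prior of variance [x] after one observation:
    the precisions [1 / x] and [1 / s2] add up. *)
Definition post_var (x : R) := (x * s2 / (x + s2))%R.

Definition var_after n : R := iter n post_var v.

Lemma post_var_gt0 x : (0 < x)%R -> (0 < post_var x)%R.
Proof. by move=> x0; rewrite divr_gt0 ?mulr_gt0 ?addr_gt0. Qed.

Lemma var_after_gt0 n : (0 < var_after n)%R.
Proof. by elim: n => //= n; exact: post_var_gt0. Qed.

(** The posterior mean, updated one observation at a time as in the Kalman
    filter. *)
Fixpoint mean_after n (w : Omega M) : R :=
  if n is k.+1 then
    (mean_after k w +
     var_after k / (var_after k + s2) * (Y k w - mean_after k w))%R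
  else u.

Definition filtration_gen n : set (set (Omega M)) :=
  \big[setU/set0]_(i < n) preimage_set_system setT (Y i) measurable.

Lemma filtrationE n : F n = <<s filtration_gen n >>.
Proof. by []. Qed.

Lemma filtration_genE n A : filtration_gen n A <->
  exists i B, [/\ (i < n)%N, measurable B & A = Y i @^-1` B].
Proof.
rewrite /filtration_gen.
rewrite -(bigcup_mkord n (fun i => preimage_set_system setT (Y i) measurable)).
split.
  move=> [i ni [B mB <-]]; exists i, B; split => //; by rewrite setTI.
by move=> [i [B [ni mB ->]]]; exists i => //; exists B => //; rewrite setTI.
Qed.

Lemma filtration_reward n i B : (i < n)%N -> measurable B -> F n (Y i @^-1` B).
Proof.
move=> ni mB; rewrite filtrationE; apply: sub_sigma_algebra.
by apply/filtration_genE; exists i, B.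
Qed.

Lemma filtration_sub n (G : set (set (Omega M))) :
  (forall i B, (i < n)%N -> measurable B -> <<s G >> (Y i @^-1` B)) ->
  F n `<=` <<s G >>.
Proof.
move=> GY; apply: smallest_sub; first exact: smallest_sigma_algebra.
by move=> A /filtration_genE[i [B [ni mB ->]]]; exact: GY.
Qed.

Lemma filtrationS n : F n `<=` F n.+1.
Proof.
by apply: filtration_sub => i B ni mB; apply: filtration_reward => //; exact: ltnW.
Qed.

Lemma filtration_measurable n : F n `<=` measurable.
Proof.
apply: smallest_sub; first exact: sigma_algebra_measurable.
move=> A /filtration_genE[i [B [ni mB ->]]].
by rewrite -[X in measurable X]setTI; exact: measurable_reward.
Qed.

Lemma reward_filtration n i : (i < n)%N ->
  measurable_fun [set: g_sigma_algebraType (filtration_gen n)]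
    (Y i : g_sigma_algebraType (filtration_gen n) -> R).
Proof.
by move=> ni _ B mB; rewrite setTI; exact: filtration_reward.
Qed.

Lemma mean_after_filtration n :
  measurable_fun [set: g_sigma_algebraType (filtration_gen n)]
    (mean_after n : g_sigma_algebraType (filtration_gen n) -> R).
Proof.
elim: n => [|n IH] /=; first exact: measurable_cst.
have mm := measurable_fun_sub_sigma (@filtrationS n) IH.
apply: measurable_funD => //; apply: measurable_funM => //.
by apply: measurable_funB => //; exact: reward_filtration.
Qed.

Lemma measurable_mean_after n : measurable_fun [set: Omega M] (mean_after n).
Proof.
move=> _ B mB; rewrite setTI; apply: (@filtration_measurable n).
exact: preimage_sigma (@mean_after_filtration n) mB.
Qed.

Lemma filtration_cylinders n : F n `<=` <<s @theta_reward_cylinders _ _ _ _ M n >>.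
Proof.
apply: filtration_sub => i B ni mB; apply: sub_sigma_algebra.
exists setT, (fun j => if j == i then B else setT); split => //.
  by move=> j; case: ifP.
rewrite preimage_setT setTI; apply/seteqP; split => [w Bw j _ /=|w /(_ i ni)] /=.
  by case: eqP => // ->.
by rewrite eqxx.
Qed.

Definition deviation n w : R := (th w - mean_after n w)%R.
Definition innovation n w : R := (Y n w - mean_after n w)%R.

Lemma measurable_deviation n : measurable_fun [set: Omega M] (deviation n).
Proof.
by apply: measurable_funB; [exact: measurable_theta|exact: measurable_mean_after].
Qed.

Lemma measurable_innovation n : measurable_fun [set: Omega M] (innovation n).
Proof.
by apply: measurable_funB; [exact: measurable_reward|exact: measurable_mean_after].
Qed.

Lemma noise_after n (E : set (Omega M)) A B :
  F n E -> measurable A -> measurable B ->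
  P (E `&` deviation n @^-1` A `&` (fun w => Y n w - th w)%R @^-1` B) =
  P (E `&` deviation n @^-1` A) * gauss s2 B.
Proof.
move=> FE mA mB; apply: (noise_indep s0) => //.
apply: setI_sigma; first exact: filtration_cylinders.
apply: preimage_sigma => //; apply: measurable_funB.
  move=> _ C mC; rewrite setTI; apply: sub_sigma_algebra.
  exists C, (fun=> setT); split => //.
  by rewrite [X in _ `&` X](_ : _ = setT) ?setIT// -subTset.
apply: measurable_fun_sub_sigma (@mean_after_filtration n).
exact: filtration_cylinders.
Qed.

Lemma posterior0 : indep_law P (F 0) (deviation 0) (gauss v).
Proof.
apply: (@indep_law_sub _ _ _ _ _ <<s [set setT] >>).
  by apply: filtration_sub.
apply: indep_law_sigma => //.
- by move=> _ ->; exact: measurableT.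
- by move=> _ _ -> ->; rewrite setTI.
- exact: measurable_deviation.
move=> _ B -> mB; rewrite setTI probability_setT mul1e.
rewrite (_ : deviation 0 @^-1` B = th @^-1` [set x | B (x - u)%R])//.
have mC : measurable [set x : R | B (x - u)%R].
  have mu' : measurable_fun [set: R] (fun x : R => x - u)%R.
    exact: measurable_funB.
  by rewrite -[X in measurable X]setTI; exact: mu'.
rewrite -[LHS]/(distribution P th _) prior_law// normal_prob_shift//.
rewrite -[X in _ = gauss v X]setIT -integral_indic//.
apply: eq_integral => x _; congr (_%:E); rewrite !indicE; congr (nat_of_bool _)%:R.
by apply/idP/idP; rewrite !inE/= addrC addKr.
Qed.

(** One Bayesian update: deviation and noise are independent normal variables,
    and the rotation takes them to the innovation and the next deviation. *)
Lemma innovation_deviation_law n (E : set (Omega M)) A B :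
  indep_law P (F n) (deviation n) (gauss (var_after n)) ->
  F n E -> measurable A -> measurable B ->
  P (E `&` innovation n @^-1` B `&` deviation n.+1 @^-1` A) =
  P E * gauss (var_after n + s2)%R B * gauss (var_after n.+1) A.
Proof.
move=> post FE mA mB; set x := var_after n; have x0 : (0 < x)%R := var_after_gt0 n.
have mE := filtration_measurable FE.
pose f (z : R * R) : \bar R := (\1_B z.1)%:E * (\1_A z.2)%:E.
have m1 (C : set R) : measurable C ->
    measurable_fun [set: R] (fun t : R => (\1_C t)%:E : \bar R).
  by move=> mC; apply/measurable_EFinP; exact: measurable_indic.
have mfst : measurable_fun [set: R * R] (fst : R * R -> R) by [].
have msnd : measurable_fun [set: R * R] (snd : R * R -> R) by [].
have mf : measurable_fun [set: R * R] f.
  by apply: emeasurable_funM;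
    [exact: (measurableT_comp (m1 _ mB) mfst)|exact: (measurableT_comp (m1 _ mA) msnd)].
have f0 z : 0 <= f z by rewrite mule_ge0// lee_fin.
pose g (z : R * R) := f (z.1 + z.2, z.1 - x / (x + s2) * (z.1 + z.2))%R.
have mg : measurable_fun [set: R * R] g.
  have md : measurable_fun [set: R * R] (fun z : R * R => z.1 + z.2)%R.
    exact: measurable_funD.
  apply: (measurableT_comp mf); apply: measurable_fun_pair => //.
  by apply: measurable_funB => //; exact: measurable_funM.
have g0 z : 0 <= g z by exact: f0.
have mnoise : measurable_fun [set: Omega M] (fun w => Y n w - th w)%R.
  by apply: measurable_funB; [exact: measurable_reward|exact: measurable_theta].
have mG : measurable (E `&` innovation n @^-1` B `&` deviation n.+1 @^-1` A).
  apply: measurableI; first apply: measurableI => //.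
    by rewrite -[X in measurable X]setTI; exact: measurable_innovation.
  by rewrite -[X in measurable X]setTI; exact: measurable_deviation.
transitivity (\int[P]_(w in E) g (deviation n w, (Y n w - th w)%R)).
  rewrite -[X in P X]setIT -integral_indic// [RHS]integral_mkcond.
  apply: eq_integral => w _; rewrite patchE /g /f /=.
  have -> : (deviation n w + (Y n w - th w) = innovation n w)%R.
    by rewrite /deviation /innovation; ring.
  have -> : (deviation n w - x / (x + s2) * innovation n w = deviation n.+1 w)%R.
    by rewrite /deviation /innovation /= -/x; ring.
  rewrite -EFinM !indicE !in_setI.
  by case: ifPn => // _; rewrite -natrM mulnb.
have mD := @measurable_deviation n.
rewrite (integral_indep mE mD mnoise (fun C D => noise_after FE) mg g0).
have mI := measurable_integral_snd (gauss s2) mg g0.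
have I0 t : 0 <= \int[gauss s2]_y g (t, y) by exact: integral_ge0.
rewrite (integral_indep_law mD post FE mE mI I0).
rewrite (integral_gauss_rotation x0 s0 mf f0) -muleA; congr (_ * _).
transitivity (\int[gauss (x + s2)%R]_t ((\1_B t)%:E * gauss (var_after n.+1) A)).
  apply: eq_integral => t _.
  have i0 : 0 <= (\1_B t)%:E :> \bar R by rewrite lee_fin.
  have A0 (y : R) : [set: R] y -> 0 <= (\1_A y)%:E :> \bar R.
    by move=> _; rewrite lee_fin.
  apply: etrans (ge0_integralZl _ measurableT (m1 _ mA) A0 i0) _.
  by congr (_ * _); rewrite integral_indic// setIT.
have B0 (y : R) : [set: R] y -> 0 <= (\1_B y)%:E :> \bar R.
  by move=> _; rewrite lee_fin.
have gA0 : 0 <= gauss (var_after n.+1) A by [].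
apply: etrans (ge0_integralZr _ measurableT (m1 _ mB) B0 gA0) _.
by congr (_ * _); rewrite integral_indic// setIT.
Qed.

Let innovation_of_posterior n :
  indep_law P (F n) (deviation n) (gauss (var_after n)) ->
  indep_law P (F n) (innovation n) (gauss (var_after n + s2)%R).
Proof.
move=> post E B FE mB.
have e := innovation_deviation_law post FE measurableT mB.
have gT : gauss (var_after n.+1) setT = 1 by exact: probability_setT.
apply: etrans (etrans e _); first by congr (P _); rewrite preimage_setT setIT.
by apply: etrans (congr1 (mule _) gT) _; exact: mule1.
Qed.

(** The innovation brings the same information as the reward, the mean being
    already known, but it is independent of the past. *)
Definition innovation_gen n : set (set (Omega M)) :=
  [set E `&` innovation n @^-1` B | E in F n & B in measurable].

Lemma filtrationS_innovation n : F n.+1 `<=` <<s innovation_gen n >>.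
Proof.
have Fsub : F n `<=` <<s innovation_gen n >>.
  move=> E FE; apply: sub_sigma_algebra; exists E => //; exists setT => //.
  by rewrite preimage_setT setIT.
apply: filtration_sub => i B; rewrite ltnS leq_eqVlt => /predU1P[-> mB|ni mB].
  pose mT := g_sigma_algebraType (innovation_gen n).
  have mm : measurable_fun [set: mT] (mean_after n : mT -> R).
    exact: measurable_fun_sub_sigma (@mean_after_filtration n).
  have mi : measurable_fun [set: mT] (innovation n : mT -> R).
    move=> _ C mC; rewrite setTI; apply: sub_sigma_algebra.
    exists setT; first exact: (@measurableT _ (g_sigma_algebraType (filtration_gen n))).
    by exists C => //; rewrite setTI.
  have mY : measurable_fun [set: mT] (fun w : mT => mean_after n w + innovation n w)%R.
    exact: measurable_funD.
  have -> : Y n @^-1` B = (fun w => mean_after n w + innovation n w)%R @^-1` B.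
    by apply/funext => w; rewrite /preimage /= /innovation addrC subrK.
  exact: (preimage_sigma mY mB).
by apply: Fsub; exact: filtration_reward.
Qed.

(** Conjugacy of the normal prior, by induction: the events known at step [n.+1]
    are generated by those known at step [n] and the innovation, for which
    [innovation_deviation_law] gives the law of the next deviation. *)
Lemma posterior n : indep_law P (F n) (deviation n) (gauss (var_after n)).
Proof.
elim: n => [|n IH]; first exact: posterior0.
apply: (indep_law_sub (@filtrationS_innovation n)); apply: indep_law_sigma.
- move=> _ [E FE [B mB <-]]; apply: measurableI; first exact: filtration_measurable FE.
  by rewrite -[X in measurable X]setTI; exact: measurable_innovation.
- move=> _ _ [E FE [B mB <-]] [E' FE' [B' mB' <-]].
  exists (E `&` E'); first exact: setI_sigma.
  by exists (B `&` B'); [exact: measurableI|rewrite preimage_setI setIACA].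
- exists setT; first exact: (@measurableT _ (g_sigma_algebraType (filtration_gen n))).
  by exists setT => //; rewrite preimage_setT setTI.
- exact: measurable_deviation.
- move=> _ A [E FE [B mB <-]] mA; rewrite innovation_deviation_law//.
  by rewrite (innovation_of_posterior IH).
Qed.

Lemma innovation_indep n :
  indep_law P (F n) (innovation n) (gauss (var_after n + s2)%R).
Proof. exact/innovation_of_posterior/posterior. Qed.

(** Variance of the step of the posterior mean; it equals
    [x - post_var x]. *)
Definition step_var (x : R) := (x ^+ 2 / (x + s2))%R.

(** Each step of the posterior mean is a multiple of an innovation, hence normal
    and independent of the past: the mean is a Gaussian random walk. *)
Lemma mean_transition n (E : set (Omega M)) (h : R -> \bar R) :
  F n E -> measurable_fun [set: R] h -> (forall x, 0 <= h x) ->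
  \int[P]_(w in E) h (mean_after n.+1 w) =
  \int[P]_(w in E) \int[gauss (step_var (var_after n))]_x h (mean_after n w + x)%R.
Proof.
move=> FE mh h0; set x := var_after n; have x0 : (0 < x)%R := var_after_gt0 n.
have xs0 : (0 < x + s2)%R by rewrite addr_gt0.
have k0 : (0 < x / (x + s2))%R by rewrite divr_gt0.
pose f (z : R * R) := h (z.1 + x / (x + s2) * z.2)%R.
have mf : measurable_fun [set: R * R] f.
  apply: (measurableT_comp mh); apply: measurable_funD => //.
  exact: measurable_funM.
have f0 z : 0 <= f z by exact: h0.
have mI : measurable_fun [set: Omega M] (innovation n) by exact: measurable_innovation.
transitivity (\int[P]_(w in E) f (mean_after n w, innovation n w)).
  by apply: eq_integral.
rewrite (integral_indep (nu := gauss (x + s2)%R) (filtration_measurable FE)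
  (@measurable_mean_after n) mI _ mf f0); last first.
  move=> A B mA mB; apply: innovation_indep => //; apply: setI_sigma => //.
  exact: preimage_sigma (@mean_after_filtration n) mA.
apply: eq_integral => w _.
have -> : step_var x = ((x / (x + s2)) ^+ 2 * (x + s2))%R.
  by rewrite /step_var; field; rewrite gt_eqF.
have mhm : measurable_fun [set: R] (fun y => h (mean_after n w + y)%R).
  by apply: (measurableT_comp mh); exact: measurable_funD.
exact: esym (integral_gauss_scale xs0 mhm (fun y => h0 _) k0).
Qed.

End posterior.

(** * Convex value functions *)

Section tame.
Context {R : realType}.

(** The class of functions of the posterior mean kept by the Bellman operator.
    Monotonicity gives measurability, linear growth gives integrability, and
    midpoint convexity is what makes dispersion valuable. *)
Definition tame (f : R -> R) :=
  [/\ {homo f : x y / (x <= y)%R},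
      forall x e, (f x + f x <= f (x + e) + f (x - e))%R &
      exists2 C, (0 <= C)%R & forall x, (`|f x| <= C * (1 + `|x|))%R].

Lemma tame_measurable f : tame f -> measurable_fun [set: R] f.
Proof. by case=> f_nd _ _; exact: nondecreasing_measurable. Qed.

Lemma tame_pos f : tame f -> tame (fun x => Num.max 0 (f x))%R.
Proof.
move=> [f_nd f_mid [C C0 fC]]; split.
- by move=> x y /f_nd fxy; rewrite ge_max !le_max lexx/= fxy orbT.
- move=> x e; have := f_mid x e.
  by case: (lerP 0 (f x)); case: (lerP 0 (f (x + e)%R));
    case: (lerP 0 (f (x - e)%R)) => *; lra.
- exists C => // x; apply: le_trans (fC x).
  by case: (lerP 0 (f x)) => _ //; rewrite normr0.
Qed.

Definition gauss_mean_pos (x : R) (f : R -> R) (m : R) : R :=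
  fine (\int[gauss x]_t (Num.max 0 (f (m + t)))%R%:E).

Section gauss_mean_pos.
Variables (x : R) (f : R -> R).
Hypotheses (x0 : (0 < x)%R) (tf : tame f).

Lemma measurable_pos_shift m :
  measurable_fun [set: R] (fun t : R => (Num.max 0 (f (m + t)))%R%:E).
Proof.
apply/measurable_EFinP.
apply: (measurableT_comp (tame_measurable (tame_pos tf))).
exact: measurable_funD.
Qed.

Let pos_ge0 (t : R) : 0 <= (Num.max 0 t)%R%:E.
Proof. by rewrite lee_fin le_max lexx. Qed.

Lemma gauss_mean_pos_bound : exists2 C, (0 <= C)%R &
  forall m, \int[gauss x]_t (Num.max 0 (f (m + t)))%R%:E <= (C * (1 + `|m|))%:E.
Proof.
have [_ _ [C C0 fC]] := tame_pos tf.
have Kfin : \int[gauss x]_t `|t|%:E \is a fin_num.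
  rewrite ge0_fin_numE ?gauss_abs_moment_lty//.
  by apply: integral_ge0 => t _; rewrite lee_fin.
pose K := fine (\int[gauss x]_t `|t|%:E).
have K0 : (0 <= K)%R by rewrite fine_ge0// integral_ge0// => t _; rewrite lee_fin.
exists (C * (1 + K))%R; first by rewrite mulr_ge0 ?addr_ge0.
move=> m; have mabs : measurable_fun [set: R] (fun t : R => `|t|%:E).
  by apply/measurable_EFinP; exact: normr_measurable.
have abs0 (t : R) : [set: R] t -> 0 <= `|t|%:E by move=> _; rewrite lee_fin.
have C0' : 0 <= C%:E by rewrite lee_fin.
apply: (@le_trans _ _
    (\int[gauss x]_t ((C * (1 + `|m|))%:E + C%:E * `|t|%:E))).
  apply: ge0_le_integral => //.
  - exact: measurable_pos_shift.
  - exact: (emeasurable_funD (measurable_cst _) (measurable_funeM _ mabs)).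
  - move=> t _; rewrite -EFinM -EFinD lee_fin.
    apply: le_trans (ler_norm _) (le_trans (fC _) _).
    by rewrite -mulrDr ler_wpM2l// -addrA lerD2l ler_normD.
have -> : \int[gauss x]_t ((C * (1 + `|m|))%:E + C%:E * `|t|%:E) =
    (C * (1 + `|m|))%:E + C%:E * K%:E.
  rewrite /K fineK// -(ge0_integralZl (gauss x) measurableT mabs abs0 C0').
  rewrite ge0_integralD//.
  - congr (_ + _); rewrite integral_cst//.
    by apply: etrans (congr1 (mule _) (probability_setT (gauss x))) _; exact: mule1.
  - by move=> t _; rewrite lee_fin mulr_ge0// addr_ge0.
  - by move=> t _; rewrite mule_ge0// lee_fin.
  - exact: (measurable_funeM _ mabs).
rewrite -EFinM -EFinD lee_fin -mulrDr -mulrA ler_wpM2l//.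
by have := normr_ge0 m; nra.
Qed.

Lemma gauss_mean_posE m :
  (gauss_mean_pos x f m)%:E = \int[gauss x]_t (Num.max 0 (f (m + t)))%R%:E.
Proof.
have [C C0 fC] := gauss_mean_pos_bound.
rewrite fineK// ge0_fin_numE; last exact: integral_ge0.
exact: le_lt_trans (fC m) (ltry _).
Qed.

Lemma gauss_mean_pos_ge0 m : (0 <= gauss_mean_pos x f m)%R.
Proof. by rewrite fine_ge0//; exact: integral_ge0. Qed.

End gauss_mean_pos.

Lemma le_gauss_mean_pos x f g m n : (0 < x)%R -> tame f -> tame g ->
  (forall t, f (m + t) <= g (n + t))%R ->
  (gauss_mean_pos x f m <= gauss_mean_pos x g n)%R.
Proof.
move=> x0 tf tg fg; rewrite -lee_fin !gauss_mean_posE//.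
apply: ge0_le_integral => //.
- by move=> t _; rewrite lee_fin le_max lexx.
- exact: measurable_pos_shift.
- exact: measurable_pos_shift.
- by move=> t _; rewrite lee_fin ge_max !le_max lexx/= fg orbT.
Qed.

Lemma tame_gauss_mean_pos x f : (0 < x)%R -> tame f -> tame (gauss_mean_pos x f).
Proof.
move=> x0 tf; have [f_nd f_mid _] := tf; split.
- move=> m n mn; apply: le_gauss_mean_pos => // t.
  by apply: f_nd; rewrite lerD2r.
- move=> m e; rewrite -lee_fin !EFinD !gauss_mean_posE//.
  have pos0 (y t : R) : [set: R] t -> 0 <= (Num.max 0 (f (y + t)))%R%:E.
    by move=> _; rewrite lee_fin le_max lexx.
  have mp y := measurable_pos_shift tf y.
  rewrite -(ge0_integralD (gauss x) measurableT (pos0 m) (mp m) (pos0 m) (mp m)).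
  rewrite -(ge0_integralD (gauss x) measurableT (pos0 (m + e)%R) (mp _)
    (pos0 (m - e)%R) (mp _)).
  apply: ge0_le_integral => //.
  + by move=> t _; rewrite adde_ge0// pos0.
  + by apply: emeasurable_funD.
  + by apply: emeasurable_funD.
  + move=> t _; rewrite -!EFinD lee_fin.
    have [_ /(_ (m + t) e)%R] := tame_pos tf.
    by rewrite addrAC (addrAC m t (- e)%R).
- have [C C0 fC] := gauss_mean_pos_bound x0 tf; exists C => // m.
  rewrite ger0_norm ?gauss_mean_pos_ge0// -lee_fin gauss_mean_posE//.
Qed.

(** Jensen's inequality, by pairing each value of the symmetric noise with its
    opposite. *)
Lemma max0_le_gauss_mean_pos x f m : (0 < x)%R -> tame f ->
  (Num.max 0 (f m) <= gauss_mean_pos x f m)%R.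
Proof.
move=> x0 tf; have mp := measurable_pos_shift tf m.
have pos0 t : 0 <= (Num.max 0 (f (m + t)))%R%:E :> \bar R.
  by rewrite lee_fin le_max lexx.
have pos0' (t : R) : [set: R] t -> 0 <= (Num.max 0 (f (m + t)))%R%:E by move=> _.
have posN0 (t : R) : [set: R] t -> 0 <= (Num.max 0 (f (m + - t)))%R%:E by move=> _.
have mN : measurable_fun [set: R] (fun t : R => (Num.max 0 (f (m + - t)))%R%:E).
  exact: (measurableT_comp mp (@oppr_measurable R setT)).
have : (Num.max 0 (f m) + Num.max 0 (f m) <=
    gauss_mean_pos x f m + gauss_mean_pos x f m)%R; last by lra.
rewrite -lee_fin !EFinD gauss_mean_posE// -{2}(integral_gaussN x0 mp pos0).
rewrite -(ge0_integralD (gauss x) measurableT pos0' mp posN0 mN).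
have cst1 c : \int[gauss x]_t (cst c : R -> \bar R) t = c.
  rewrite integral_cst//.
  by apply: etrans (congr1 (mule _) (probability_setT (gauss x))) _; exact: mule1.
rewrite -[leLHS]cst1; apply: ge0_le_integral => //.
- by move=> t _; rewrite -EFinD lee_fin addr_ge0// le_max lexx.
- exact: (emeasurable_funD mp mN).
move=> t _ /=; rewrite -!EFinD lee_fin.
by have [_ /(_ m t)] := tame_pos tf.
Qed.

(** The centred normal law of variance [y] is that of variance [x] plus an
    independent symmetric noise, and averaging a convex function over the noise
    can only increase it. *)
Lemma le_gauss_mean_pos_var x y f m : (0 < x)%R -> (x <= y)%R -> tame f ->
  (gauss_mean_pos x f m <= gauss_mean_pos y f m)%R.
Proof.
move=> x0; rewrite le_eqVlt => /predU1P[-> //|xy] tf.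
have y0 : (0 < y)%R by exact: lt_trans xy.
have d0 : (0 < y - x)%R by rewrite subr_gt0.
have mp := measurable_pos_shift tf.
have pos0 z t : 0 <= (Num.max 0 (f (z + t)))%R%:E :> \bar R.
  by rewrite lee_fin le_max lexx.
have le2 (a b a' b' : \bar R) : a = a' -> b = b' -> a' <= b' -> a <= b.
  by move=> -> ->.
rewrite -lee_fin.
apply: (le2 _ _ _ _ (gauss_mean_posE x0 tf m) (gauss_mean_posE y0 tf m)).
pose h (z : R * R) := (Num.max 0 (f (m + z.1)))%R%:E.
have mh : measurable_fun [set: R * R] h.
  exact: (measurableT_comp (mp m) (@measurable_fst _ _ _ _)).
have h0 z : 0 <= h z by exact: pos0.
have cst1 w (c : \bar R) : \int[gauss w]_t (cst c : R -> \bar R) t = c.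
  rewrite integral_cst//.
  by apply: etrans (congr1 (mule _) (probability_setT (gauss w))) _; exact: mule1.
have yE : (x + (y - x))%R = y by rewrite addrC subrK.
have e : \int[gauss x]_d \int[gauss (y - x)%R]_e h (d + e, 0)%R =
    \int[gauss y]_t (Num.max 0 (f (m + t)))%R%:E.
  apply: etrans (integral_gauss_rotation x0 d0 mh h0) _.
  by rewrite yE; apply: eq_integral => t _; exact: (cst1 _ (h (t, 0%R))).
apply: (le2 _ _ _ _ (erefl _) (esym e)).
apply: (ge0_le_integral (gauss x) measurableT (fun t _ => pos0 m t) (mp m)).
- pose h' (z : R * R) := (Num.max 0 (f (m + (z.1 + z.2))))%R%:E.
  have mh' : measurable_fun [set: R * R] h'.
    have md : measurable_fun [set: R * R] (fun z : R * R => z.1 + z.2)%R.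
      exact: measurable_funD.
    exact: (measurableT_comp (mp m) md).
  exact: (measurable_integral_snd (gauss (y - x)%R) mh' (fun z => pos0 _ _)).
move=> d _.
have pq : ((Num.max 0 (f (m + d)))%R%:E <=
    (gauss_mean_pos (y - x) f (m + d))%:E)%E.
  by rewrite lee_fin max0_le_gauss_mean_pos.
apply: le_trans pq _; apply: (le2 _ _ _ _ (gauss_mean_posE d0 tf (m + d)%R) (erefl _)).
by rewrite le_eqVlt; apply/orP; left; apply/eqP/eq_integral => t _; rewrite /h/= addrA.
Qed.

End tame.

Section value.
Context {R : realType} (beta s2 : R).
Hypotheses (beta0 : (0 <= beta)%R) (s0 : (0 < s2)%R).
Implicit Types (r m x : R) (k : nat).

(** Optimal expected value of [beta^0 (Y_0 - r) + ... + beta^(j-1) (Y_(j-1) - r)]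
    over the stopping times [1 <= j <= k], when the prior is [N(m, x)]. *)
Fixpoint value r k x m : R :=
  if k is j.+1 then
    (m - r + beta * gauss_mean_pos (step_var s2 x) (value r j (post_var s2 x)) m)%R
  else 0%R.

Lemma step_var_gt0 x : (0 < x)%R -> (0 < step_var s2 x)%R.
Proof. by move=> x0; rewrite divr_gt0 ?exprn_gt0 ?addr_gt0. Qed.

Lemma le_step_var x y : (0 < x)%R -> (x <= y)%R ->
  (step_var s2 x <= step_var s2 y)%R.
Proof.
move=> x0 xy; have y0 : (0 < y)%R by exact: lt_le_trans xy.
rewrite /step_var ler_pdivrMr ?addr_gt0// mulrAC ler_pdivlMr ?addr_gt0//.
have : (0 <= (y - x) * (x * y + s2 * (x + y)))%R; last by nra.
by rewrite mulr_ge0 ?subr_ge0// addr_ge0 ?mulr_ge0 ?addr_ge0// ltW.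
Qed.

Lemma le_post_var x y : (0 < x)%R -> (x <= y)%R ->
  (post_var s2 x <= post_var s2 y)%R.
Proof.
move=> x0 xy; have y0 : (0 < y)%R by exact: lt_le_trans xy.
rewrite /post_var ler_pdivrMr ?addr_gt0// mulrAC ler_pdivlMr ?addr_gt0//.
have : (0 <= s2 ^+ 2 * (y - x))%R; last by nra.
by rewrite mulr_ge0 ?subr_ge0// exprn_ge0// ltW.
Qed.

Lemma tame_value r k x : (0 < x)%R -> tame (value r k x).
Proof.
elim: k x => [|k IH] x x0 /=.
  by split => //; exists 0%R => // y; rewrite normr0 mul0r.
have := tame_gauss_mean_pos (step_var_gt0 x0) (IH _ (post_var_gt0 s0 x0)).
set W := gauss_mean_pos _ _ => -[W_nd W_mid [C C0 WC]]; split.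
- by move=> m n mn; rewrite lerD// ?lerB// ler_wpM2l// W_nd.
- by move=> m e; have := ler_wpM2l beta0 (W_mid m e); lra.
- exists (1 + `|r| + beta * C)%R; first by rewrite !addr_ge0// mulr_ge0.
  move=> m; apply: le_trans (ler_normD _ _) _.
  rewrite mulrDl lerD//.
    apply: le_trans (ler_normB _ _) _.
    by have := normr_ge0 m; have := normr_ge0 r; nra.
  by rewrite normrM ger0_norm// -mulrA ler_wpM2l.
Qed.

(** The translations of the prior mean and of the charge cancel out. A larger
    prior variance stays larger along the posterior variances and makes the steps
    of the posterior mean more dispersed, which convexity rewards. *)
Lemma le_value r d k x y m : (0 < x)%R -> (x <= y)%R ->
  (value r k x m <= value (r + d) k y (m + d))%R.
Proof.
elim: k x y m => [//|k IH] x y m x0 xy /=.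
have y0 : (0 < y)%R by exact: lt_le_trans xy.
apply: lerD; first by rewrite opprD addrACA subrr addr0.
apply: (ler_wpM2l beta0).
have tx := tame_value r k (post_var_gt0 s0 x0).
have ty := tame_value (r + d) k (post_var_gt0 s0 y0).
have lev := le_gauss_mean_pos_var m (step_var_gt0 x0) (le_step_var x0 xy) tx.
apply: (le_trans lev); apply: (le_gauss_mean_pos (step_var_gt0 y0) tx ty) => t.
rewrite (addrAC m d t); apply: IH; first exact: (post_var_gt0 s0 x0).
exact: le_post_var.
Qed.

End value.

(** * Integrability of the rewards *)

Section moments.
Context (R : realType) (u v s2 : R) (M : normal_reward_process u v s2).
Hypotheses (v0 : (0 < v)%R) (s0 : (0 < s2)%R).
Local Notation P := (Pr M).
Local Notation th := (theta M).
Local Notation Y := (reward M).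
Local Notation F n := (natural_filtration Y n).
Local Notation mean := (@mean_after R u v s2 M).
Local Notation var := (@var_after R v s2).
Local Notation innov := (@innovation R u v s2 M).
Local Notation dev := (@deviation R u v s2 M).

Lemma filtrationT n : F n setT.
Proof. exact: (@measurableT _ (g_sigma_algebraType (@filtration_gen _ _ _ _ M n))). Qed.

Let measurable_abs : measurable_fun [set: R] (fun t : R => `|t|%:E).
Proof. by apply/measurable_EFinP; exact: normr_measurable. Qed.

Let abs_ge0 (t : R) : 0 <= `|t|%:E. Proof. by rewrite lee_fin. Qed.

Lemma gauss_abs_momentE (w : R) : (0 < w)%R -> exists2 K : R, (0 <= K)%R &
  \int[gauss w]_t `|t|%:E = K%:E.
Proof.
move=> w0; have I0 : 0 <= \int[gauss w]_t `|t|%:E by exact: integral_ge0.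
exists (fine (\int[gauss w]_t `|t|%:E)); first exact: fine_ge0.
by rewrite fineK// ge0_fin_numE// gauss_abs_moment_lty.
Qed.

(** A bound independent of [n], since all rewards are [theta] plus a noise of the
    same law: it makes the discounted sums absolutely summable. *)
Lemma reward_abs_moment : exists2 K : R, (0 <= K)%R &
  forall n, \int[P]_w `|Y n w|%:E <= K%:E.
Proof.
have [Kv Kv0 KvE] := gauss_abs_momentE v0.
have [Ks Ks0 KsE] := gauss_abs_momentE s0.
exists (`|u| + Kv + Ks)%R; first by rewrite !addr_ge0.
move=> n.
have mD : measurable_fun [set: Omega M] (dev 0) by exact: measurable_deviation.
have mN : measurable_fun [set: Omega M] (fun w => Y n w - th w)%R.
  by apply: measurable_funB; [exact: measurable_reward|exact: measurable_theta].
have PT : P setT = 1 by exact: probability_setT.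
have eD : \int[P]_w `|dev 0 w|%:E = Kv%:E.
  have := integral_indep_law mD (@posterior _ _ _ _ M v0 s0 0) (@filtrationT 0) measurableT
    measurable_abs abs_ge0.
  by rewrite PT mul1e KvE.
have eN : \int[P]_w `|Y n w - th w|%:E = Ks%:E.
  have cT : <<s @theta_reward_cylinders _ _ _ _ M n >> setT.
    exact: (@measurableT _ (g_sigma_algebraType (@theta_reward_cylinders _ _ _ _ M n))).
  have := integral_indep_law mN (@noise_indep _ _ _ _ M s0 n) cT measurableT measurable_abs abs_ge0.
  by rewrite PT mul1e KsE.
have mDa : measurable_fun [set: Omega M] (fun w => `|dev 0 w|%:E).
  exact: (measurableT_comp measurable_abs mD).
have mNa : measurable_fun [set: Omega M] (fun w => `|Y n w - th w|%R%:E).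
  exact: (measurableT_comp measurable_abs mN).
have cstE : \int[P]_w (cst `|u|%:E : Omega M -> \bar R) w = `|u|%:E.
  by rewrite integral_cst//; apply: etrans (congr1 (mule _) PT) _; exact: mule1.
have g1 (w : Omega M) : [set: Omega M] w -> 0 <= `|u|%:E by move=> _.
have g2 (w : Omega M) : [set: Omega M] w -> 0 <= `|dev 0 w|%:E by move=> _.
have g3 (w : Omega M) : [set: Omega M] w -> 0 <= `|Y n w - th w|%:E by move=> _.
have g12 (w : Omega M) : [set: Omega M] w -> 0 <= `|u|%:E + `|dev 0 w|%:E.
  by move=> _; exact: adde_ge0.
have m12 : measurable_fun [set: Omega M] (fun w => `|u|%:E + `|dev 0 w|%:E).
  exact: (emeasurable_funD (measurable_cst _) mDa).
have -> : (`|u| + Kv + Ks)%:E =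
    \int[P]_w (`|u|%:E + `|dev 0 w|%:E + `|Y n w - th w|%R%:E).
  rewrite (ge0_integralD P measurableT g12 m12 g3 mNa) eN.
  by rewrite (ge0_integralD P measurableT g1 (measurable_cst _) g2 mDa) eD cstE.
apply: (ge0_le_integral P measurableT).
- by move=> w _.
- exact: (measurableT_comp measurable_abs (@measurable_reward _ _ _ _ M n)).
- exact: (emeasurable_funD m12 mNa).
move=> w _; rewrite -!EFinD lee_fin.
have e : (`|Y n w| = `|u + dev 0 w + (Y n w - th w)|)%R.
  by congr (`|_|)%R; rewrite /deviation/=; ring.
by rewrite [leLHS]e (le_trans (ler_normD _ _))// lerD2r ler_normD.
Qed.

Lemma integrable_reward n : P.-integrable setT (fun w => (Y n w)%:E).
Proof.
have [K K0 YK] := reward_abs_moment; apply/integrableP; split.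
  by apply/measurable_EFinP; exact: measurable_reward.
exact: le_lt_trans (YK n) (ltry K).
Qed.

Lemma integrable_mean n : P.-integrable setT (fun w => (mean n w)%:E).
Proof.
elim: n => [|n IH]; first exact: finite_measure_integrable_cst.
have iB := integrableB measurableT (integrable_reward n) IH.
have iZ := integrableZl measurableT (var n / (var n + s2))%R iB.
exact: (integrableD measurableT IH iZ).
Qed.

Lemma integrable_tame_mean f n : tame f ->
  P.-integrable setT (fun w => (f (mean n w))%:E).
Proof.
move=> tf; have [_ _ [C C0 fC]] := tf.
have i1 : P.-integrable setT (fun w : Omega M => C%:E * (1%:E + `|mean n w|%:E)).
  apply: integrableZl => //; apply: integrableD => //.
    exact: finite_measure_integrable_cst.
  exact: (integrable_abse (integrable_mean n)).
apply: le_integrable i1 => //.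
  apply/measurable_EFinP.
  exact: (measurableT_comp (tame_measurable tf) (@measurable_mean_after _ _ _ _ M n)).
move=> w _; rewrite -EFinD -EFinM /= lee_fin.
by rewrite (le_trans (fC _))// ler_norm.
Qed.

(** Positive and negative parts have the same integral, as the centred normal
    laws are symmetric. *)
Lemma integral_innovation n E : F n E -> \int[P]_(w in E) (innov n w)%:E = 0.
Proof.
move=> FE; have mE := filtration_measurable FE.
have mI : measurable_fun [set: Omega M] (innov n) by exact: measurable_innovation.
have xs0 : (0 < var n + s2)%R by rewrite addr_gt0// var_after_gt0.
pose p (t : R) : \bar R := (Num.max t 0)%R%:E.
have mp : measurable_fun [set: R] p.
  by apply/measurable_EFinP; exact: measurable_maxr.
have p0 t : 0 <= p t by rewrite lee_fin le_max lexx orbT.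
have mpN : measurable_fun [set: R] (fun t => p (- t)%R).
  exact: (measurableT_comp mp (@oppr_measurable R setT)).
have ii := @innovation_indep _ _ _ _ M v0 s0 n.
have e1 := integral_indep_law mI ii FE mE mp p0.
have e2 := integral_indep_law mI ii FE mE mpN (fun t => p0 (- t)%R).
have fin : P E * \int[gauss (var n + s2)%R]_x p x \is a fin_num.
  rewrite fin_numM ?fin_num_measure// ge0_fin_numE; last exact: integral_ge0.
  have [K K0 KE] := gauss_abs_momentE xs0.
  rewrite (@le_lt_trans _ _ K%:E) ?ltry// -KE.
  apply: (ge0_le_integral (gauss (var n + s2)%R) measurableT (fun t _ => p0 t) mp).
    exact: measurable_abs.
  by move=> t _; rewrite lee_fin ge_max ler_norm normr_ge0.
rewrite integralE.
have -> : \int[P]_(w in E) ((fun w => (innov n w)%:E)^\+ w) =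
    P E * \int[gauss (var n + s2)%R]_x p x.
  apply: etrans e1; apply: eq_integral => w _.
  by rewrite funeposE /p EFin_max.
have -> : \int[P]_(w in E) ((fun w => (innov n w)%:E)^\- w) =
    P E * \int[gauss (var n + s2)%R]_x p x.
  apply: etrans (etrans e2 _); first apply: eq_integral => w _.
    by rewrite funenegE /p EFin_max EFinN.
  by congr (_ * _); exact: (integral_gaussN xs0 mp p0).
exact: subee.
Qed.

Lemma Rintegral_reward n E : F n E ->
  (\int[P]_(w in E) Y n w = \int[P]_(w in E) mean n w)%R.
Proof.
move=> FE; have mE := filtration_measurable FE.
have iY : P.-integrable E (EFin \o Y n).
  exact: integrableS measurableT mE (@subsetT _ _) (integrable_reward n).
have im : P.-integrable E (EFin \o mean n).
  exact: integrableS measurableT mE (@subsetT _ _) (integrable_mean n).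
apply/eqP; rewrite -subr_eq0 -(RintegralB mE iY im); apply/eqP.
by rewrite /Rintegral -/(innov n _) integral_innovation.
Qed.

End moments.

(** * Dynamic programming *)

Section dynamic_programming.
Context (R : realType) (u v s2 beta : R) (M : normal_reward_process u v s2).
Hypotheses (v0 : (0 < v)%R) (s0 : (0 < s2)%R) (beta0 : (0 <= beta)%R).
Local Notation P := (Pr M).
Local Notation Y := (reward M).
Local Notation F n := (natural_filtration Y n).
Local Notation mean := (@mean_after R u v s2 M).
Local Notation var := (@var_after R v s2).

Definition value_after r k n (w : Omega M) : R :=
  value beta s2 r k (var n) (mean n w).

Lemma integrable_event (E : set (Omega M)) (f : Omega M -> \bar R) : measurable E ->
  P.-integrable setT f -> P.-integrable E f.
Proof. by move=> mE; apply: integrableS => //; exact: measurableT. Qed.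

Lemma integrable_value_after r k n :
  P.-integrable setT (EFin \o value_after r k n).
Proof.
have tv := tame_value beta0 s0 r k (@var_after_gt0 _ _ _ v0 s0 n).
exact: (@integrable_tame_mean _ _ _ _ M v0 s0 _ n tv).
Qed.

Lemma integrable_value_pos r k n :
  P.-integrable setT (EFin \o (fun w => Num.max 0 (value_after r k n w))%R).
Proof.
have tv := tame_pos (tame_value beta0 s0 r k (@var_after_gt0 _ _ _ v0 s0 n)).
exact: (@integrable_tame_mean _ _ _ _ M v0 s0 _ n tv).
Qed.

Lemma integrable_excess r n : P.-integrable setT (EFin \o (fun w => Y n w - r)%R).
Proof.
have := integrableB measurableT (@integrable_reward _ _ _ _ M v0 s0 n)
  (finite_measure_integrable_cst P r measurableT).
by [].
Qed.

(** Splits off the next reward, whose expectation is the posterior mean, and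
    moves the mean by one step of the random walk. *)
Lemma bellman r k n (E : set (Omega M)) : F n E ->
  (\int[P]_(w in E) value_after r k.+1 n w =
   \int[P]_(w in E) (Y n w - r) +
   beta * \int[P]_(w in E) Num.max 0 (value_after r k n.+1 w))%R.
Proof.
move=> FE; have mE := filtration_measurable FE.
have x0 : (0 < var n)%R by exact: var_after_gt0.
pose f := value beta s2 r k (post_var s2 (var n)).
have tf : tame f by apply: tame_value => //; exact: post_var_gt0.
have st0 := step_var_gt0 s0 x0.
pose W := gauss_mean_pos (step_var s2 (var n)) f.
have tW : tame W by exact: tame_gauss_mean_pos.
have iW : P.-integrable E (EFin \o (W \o mean n)).
  exact: integrable_event mE (@integrable_tame_mean _ _ _ _ M v0 s0 _ n tW).
have im : P.-integrable E (EFin \o mean n).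
  exact: integrable_event mE (@integrable_mean _ _ _ _ M v0 s0 n).
have iY : P.-integrable E (EFin \o Y n).
  exact: integrable_event mE (@integrable_reward _ _ _ _ M v0 s0 n).
have ic : P.-integrable E (EFin \o cst r).
  exact: finite_measure_integrable_cst.
have imr : P.-integrable E (EFin \o (fun w => mean n w - r)%R).
  exact: (integrableB mE im ic).
have ibW : P.-integrable E (EFin \o (fun w => beta * W (mean n w))%R).
  exact: (integrableZl mE beta iW).
rewrite (_ : (\int[P]_(w in E) value_after r k.+1 n w)%R =
  (\int[P]_(w in E) ((mean n w - r) + beta * W (mean n w)))%R)//.
rewrite (RintegralD mE imr ibW) (RintegralZl _ mE iW).
congr (_ + _ * _)%R.
  by rewrite (RintegralB mE im ic) (RintegralB mE iY ic) Rintegral_reward.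
pose h (t : R) := (Num.max 0 (f t))%R%:E.
have mh : measurable_fun [set: R] h.
  by apply/measurable_EFinP; exact: tame_measurable (tame_pos tf).
have h0 t : 0 <= h t by rewrite lee_fin le_max lexx.
congr fine; apply/esym; apply: etrans (mean_transition v0 s0 FE mh h0) _.
by apply: eq_integral => w _; rewrite /W /= gauss_mean_posE.
Qed.

(** Backward induction: restricting the next value to the event on which one goes
    on gives at most its positive part. *)
Lemma value_upper r (e : nat -> set (Omega M)) :
  (forall n, F n (e n)) -> (forall n, e n.+1 `<=` e n) -> forall k n,
  (\sum_(i < k) beta ^+ i * \int[P]_(w in e (n + i)%N) (Y (n + i)%N w - r) <=
   \int[P]_(w in e n) value_after r k n w)%R.
Proof.
move=> Fe ne; elim=> [|k IH] n.
  by rewrite big_ord0 Rintegral_ge0.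
rewrite big_ord_recl addn0 expr0 mul1r bellman// lerD2l.
have me m : measurable (e m) := filtration_measurable (Fe m).
under eq_bigr do rewrite lift0 exprS -mulrA addnS -addSn.
rewrite -mulr_sumr ler_wpM2l//; apply: le_trans (IH n.+1) _.
apply: (@le_trans _ _
  (\int[P]_(w in e n.+1) Num.max 0 (value_after r k n.+1 w))%R).
  apply: le_Rintegral => //.
  - by apply: integrable_event => //; exact: integrable_value_after.
  - by apply: integrable_event => //; exact: integrable_value_pos.
  - by move=> w _; rewrite le_max lexx orbT.
rewrite Rintegral_mkcond [leRHS]Rintegral_mkcond; apply: le_Rintegral => //.
- rewrite -restrict_EFin -integrable_mkcond//; apply: integrable_event => //.
  exact: integrable_value_pos.
- rewrite -restrict_EFin -integrable_mkcond//; apply: integrable_event => //.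
  exact: integrable_value_pos.
move=> w _; rewrite !patchE; case: ifPn => [/set_mem ew|_].
  by rewrite (mem_set (ne _ _ ew)).
by case: ifPn => // _; rewrite le_max lexx.
Qed.

(** Going on exactly when the remaining value is positive turns the inequality of
    [value_upper] into an equality. The rule stops at a horizon [N > 0], where
    the remaining value is [0]. *)
Fixpoint optimal_rule r N n : set (Omega M) :=
  if n is j.+1 then
    optimal_rule r N j `&` [set w | (0 < value_after r (N - j.+1) j.+1 w)%R]
  else setT.

Lemma optimal_rule_filtration r N n : F n (optimal_rule r N n).
Proof.
elim: n => [|n IH] /=; first exact: filtrationT.
apply: setI_sigma; first exact: filtrationS.
have mv := tame_measurable (tame_value beta0 s0 r (N - n.+1) (var_after_gt0 v0 s0 n.+1)).
pose mT := g_sigma_algebraType (@filtration_gen _ _ _ _ M n.+1).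
have mV : measurable_fun [set: mT] (value_after r (N - n.+1) n.+1 : mT -> R).
  exact: (measurableT_comp mv (@mean_after_filtration _ _ _ _ M n.+1)).
rewrite (_ : [set w | _] = value_after r (N - n.+1) n.+1 @^-1` `]0%R, +oo[%classic).
  exact: (preimage_sigma mV).
by apply/seteqP; split => w /=; rewrite in_itv/= andbT.
Qed.

Lemma optimal_rule_horizon r N : (0 < N)%N -> optimal_rule r N N = set0.
Proof.
case: N => // N _ /=; rewrite subnn; apply/seteqP; split => // w [_ /=].
by rewrite ltxx.
Qed.

Lemma optimal_rule_value r N k n : (k + n = N)%N ->
  (\sum_(i < k) beta ^+ i *
     \int[P]_(w in optimal_rule r N (n + i)%N) (Y (n + i)%N w - r) =
   \int[P]_(w in optimal_rule r N n) value_after r k n w)%R.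
Proof.
elim: k n => [|k IH] n knN; have Fn := @optimal_rule_filtration r N n.
  by rewrite big_ord0 Rintegral_cst ?mul0r//; exact: filtration_measurable Fn.
rewrite big_ord_recl addn0 expr0 mul1r bellman//; congr (_ + _)%R.
under eq_bigr do rewrite lift0 exprS -mulrA addnS -addSn.
rewrite -mulr_sumr IH ?addnS//; congr (_ * _)%R.
rewrite Rintegral_mkcond [RHS]Rintegral_mkcond; apply: eq_Rintegral => w _.
have -> : k = (N - n.+1)%N by rewrite -knN addSnnS addnK.
rewrite !patchE /= in_setI; case: ifPn => [/andP[-> /set_mem/= /ltW v_ge0]|].
  by rewrite max_r.
rewrite negb_and; case: ifPn => //= _ /negP nv.
by rewrite max_l// leNgt; apply/negP => v_gt0; apply: nv; exact/mem_set.
Qed.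

End dynamic_programming.

(** * Stopping times as decreasing events *)

Section stopping.
Context (R : realType) (u v s2 beta : R) (M : normal_reward_process u v s2).
Hypotheses (v0 : (0 < v)%R) (s0 : (0 < s2)%R).
Hypotheses (beta0 : (0 < beta)%R) (beta1 : (beta < 1)%R).
Local Notation P := (Pr M).
Local Notation Y := (reward M).
Local Notation F n := (natural_filtration Y n).
Implicit Types (r : R) (xi : Omega M -> nat) (i N : nat) (w : Omega M).

Definition going_on (xi : Omega M -> nat) i : set (Omega M) :=
  [set w | (i < xi w)%N].

Lemma going_on_filtration xi i : stopping_time Y xi -> F i (going_on xi i).
Proof.
move=> st; rewrite (_ : going_on xi i = ~` [set w | (xi w <= i)%N]).
  exact: (@measurableC _ (g_sigma_algebraType (@filtration_gen _ _ _ _ M i))) (st i).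
by apply/seteqP; split => w /=; rewrite /going_on/= ltnNge => /negP.
Qed.

Definition payoff r xi N (w : Omega M) : R :=
  (\sum_(0 <= i < N) beta ^+ i * ((fun w => Y i w - r) \_ (going_on xi i)) w)%R.

Definition net_reward r xi (w : Omega M) : R :=
  (discounted_reward beta xi w - r * discounted_time beta xi w)%R.

Lemma payoff_stopped r xi N w : (xi w <= N)%N ->
  payoff r xi N w = net_reward r xi w.
Proof.
move=> xiN; rewrite /payoff /net_reward /discounted_reward /discounted_time.
rewrite mulr_sumr -sumrB.
rewrite (big_cat_nat (n := xi w))//= [X in (_ + X)%R]big_nat_cond.
rewrite [X in (_ + X)%R]big1 ?addr0; last first.
  move=> i /andP[/andP[xii _] _]; rewrite patchE memNset ?mulr0//.
  by rewrite /going_on/= ltnNge xii.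
apply: eq_big_nat => i /andP[_ ixi]; rewrite patchE mem_set//.
by rewrite mulrBr (mulrC r).
Qed.

Lemma integrable_payoff_term r xi i : stopping_time Y xi ->
  P.-integrable setT (EFin \o ((fun w => Y i w - r)%R \_ (going_on xi i))).
Proof.
move=> st; have mE := filtration_measurable (@going_on_filtration xi i st).
rewrite -restrict_EFin -integrable_mkcond//; apply: integrable_event => //.
exact: integrable_excess.
Qed.

Lemma integrable_payoff r xi N : stopping_time Y xi ->
  P.-integrable setT (EFin \o payoff r xi N).
Proof.
move=> st; elim: N => [|N IH].
  apply: eq_integrable (integrable0 P setT) => // w _ /=.
  by rewrite /payoff big_geq.
have iZ := integrableZl measurableT (beta ^+ N)%R (@integrable_payoff_term r xi N st).
apply: eq_integrable (integrableD measurableT IH iZ) => // w _ /=.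
by rewrite /payoff big_nat_recr//= EFinD EFinM.
Qed.

Lemma Rintegral_payoff r xi N : stopping_time Y xi ->
  (\int[P]_w payoff r xi N w =
   \sum_(i < N) beta ^+ i * \int[P]_(w in going_on xi i) (Y i w - r))%R.
Proof.
move=> st; elim: N => [|N IH].
  rewrite big_ord0 /payoff; under eq_Rintegral do rewrite big_geq//.
  by rewrite Rintegral_cst// mul0r.
have it := @integrable_payoff_term r xi N st.
have iZ : P.-integrable setT
    (EFin \o (fun w => beta ^+ N * ((fun w => Y N w - r) \_ (going_on xi N)) w)%R).
  exact: (integrableZl measurableT (beta ^+ N)%R it).
rewrite big_ord_recr/= -IH [X in (_ + _ * X)%R]Rintegral_mkcond.
rewrite -(RintegralZl _ measurableT it).
rewrite -(RintegralD measurableT (@integrable_payoff r xi N st) iZ).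
by apply: eq_Rintegral => w _; rewrite /payoff big_nat_recr.
Qed.

Definition dominating (r : R) (w : Omega M) : \bar R :=
  \sum_(0 <= i <oo) (beta ^+ i * (`|Y i w| + `|r|))%R%:E.

Let dom_ge0 r i (w : Omega M) : 0 <= (beta ^+ i * (`|Y i w| + `|r|))%R%:E.
Proof. by rewrite lee_fin mulr_ge0 ?exprn_ge0 ?addr_ge0// ltW. Qed.

Lemma payoff_dominated r xi N w : `|(payoff r xi N w)%:E| <= dominating r w.
Proof.
apply: (@le_trans _ _ (\sum_(0 <= i < N) (beta ^+ i * (`|Y i w| + `|r|))%R%:E)).
  rewrite sumEFin lee_fin (le_trans (ler_norm_sum _ _ _))//.
  apply: ler_sum => i _; rewrite normrM ger0_norm ?exprn_ge0 ?(ltW beta0)//.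
  rewrite ler_wpM2l ?exprn_ge0 ?(ltW beta0)// patchE.
  by case: ifPn => _; [exact: ler_normB|rewrite normr0 addr_ge0].
by apply: nneseries_lim_ge => i _ _; exact: dom_ge0.
Qed.

Lemma sum_geometric_le N : (\sum_(0 <= i < N) beta ^+ i <= (1 - beta)^-1)%R.
Proof.
have b1 : (0 < 1 - beta)%R by rewrite subr_gt0.
rewrite -(ler_pM2r b1) mulVf ?gt_eqF//.
have -> : ((\sum_(0 <= i < N) beta ^+ i) * (1 - beta) = 1 - beta ^+ N)%R.
  elim: N => [|N IH]; first by rewrite big_geq// mul0r expr0 subrr.
  by rewrite big_nat_recr//= mulrDl IH exprS; ring.
by rewrite gerBl exprn_ge0// ltW.
Qed.

Lemma integrable_dominating r : P.-integrable setT (dominating r).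
Proof.
have [K K0 YK] := reward_abs_moment M v0 s0.
have mabs i : measurable_fun [set: Omega M] (fun w => `|Y i w|)%R.
  exact: (measurableT_comp (@normr_measurable R setT) (@measurable_reward _ _ _ _ M i)).
have mt i : measurable_fun [set: Omega M]
    (fun w => (beta ^+ i * (`|Y i w| + `|r|))%R%:E).
  apply/measurable_EFinP; apply: measurable_funM => //.
  exact: measurable_funD.
apply/integrableP; split.
  by apply: ge0_emeasurable_sum => // i w _ _; exact: dom_ge0.
under eq_integral do rewrite gee0_abs ?nneseries_ge0//.
rewrite integral_nneseries//.
apply: (@le_lt_trans _ _ ((K + `|r|) / (1 - beta))%:E); last exact: ltry.
apply: lime_le; first by apply: is_cvg_nneseries => i _ _; exact: integral_ge0.
apply: nearW => N.
apply: (@le_trans _ _ (\sum_(0 <= i < N) (beta ^+ i * (K + `|r|))%:E)).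
  apply: lee_sum => i _.
  have mY : measurable_fun [set: Omega M] (fun w => `|Y i w|%:E).
    by apply/measurable_EFinP.
  have Y0 (w : Omega M) : [set: Omega M] w -> 0 <= `|Y i w|%:E.
    by move=> _; rewrite lee_fin.
  have r0 (w : Omega M) : [set: Omega M] w -> 0 <= `|r|%:E.
    by move=> _; rewrite lee_fin.
  have Yr0 (w : Omega M) : [set: Omega M] w -> 0 <= `|Y i w|%:E + `|r|%:E.
    by move=> _; rewrite -EFinD lee_fin addr_ge0.
  have mYr := emeasurable_funD mY (measurable_cst `|r|%:E).
  have b0 : 0 <= (beta ^+ i)%:E by rewrite lee_fin exprn_ge0// ltW.
  apply: le_trans (_ : _ <= (beta ^+ i)%:E * (K%:E + `|r|%:E)) _ => //.
  have -> : \int[P]_w (beta ^+ i * (`|Y i w| + `|r|))%:E =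
      (beta ^+ i)%:E * \int[P]_w (`|Y i w|%:E + `|r|%:E).
    exact: (ge0_integralZl P measurableT mYr Yr0 b0).
  rewrite (ge0_integralD P measurableT Y0 mY r0 (measurable_cst _)).
  apply: lee_wpmul2l => //; apply: leeD; first exact: YK.
  rewrite integral_cst// le_eqVlt; apply/orP; left; apply/eqP.
  by apply: etrans (congr1 (mule _) (probability_setT P)) _; exact: mule1.
rewrite sumEFin lee_fin -mulr_suml mulrC ler_wpM2l ?addr_ge0//.
exact: sum_geometric_le.
Qed.

(** Stopping at [N] as well costs little when [N] is large: a stopping time that
    is everywhere finite is reached in the end, and the discounted absolute
    rewards dominate. *)
Lemma net_reward_limit r xi : stopping_time Y xi ->
  P.-integrable setT (EFin \o net_reward r xi) /\
  (\int[P]_w payoff r xi N w)%R @[N --> \oo] --> (\int[P]_w net_reward r xi w)%R.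
Proof.
move=> st.
have cvg_p w : (payoff r xi N w)%:E @[N --> \oo] --> (net_reward r xi w)%:E.
  apply: cvg_near_cst; exists (xi w) => // N /= xiN.
  by rewrite payoff_stopped.
have mp N : measurable_fun [set: Omega M] (EFin \o payoff r xi N).
  exact: measurable_int (@integrable_payoff r xi N st).
have mn : measurable_fun [set: Omega M] (EFin \o net_reward r xi).
  by apply: (emeasurable_fun_cvg (fun N => EFin \o payoff r xi N)) => // w _; exact: cvg_p.
have [iN _ cv] := dominated_convergence (mu := P) measurableT mp mn
  (aeW P (fun w _ => cvg_p w)) (@integrable_dominating r)
  (aeW P (fun w N _ => payoff_dominated r xi N w)).
split => //; apply: fine_cvg.
rewrite fineK; first exact: cv.
exact: integrable_fin_num.
Qed.

End stopping.

Section stopping_of_events.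
Context d (T : measurableType d) (R : realType) (Y : nat -> T -> R).

(** Converts the rule of dynamic programming, a sequence of events, into a
    stopping time: the first time at which the event fails. *)
Lemma stopping_time_of_events (e : nat -> set T) (N : nat) :
  (forall n, natural_filtration Y n (e n)) ->
  (forall n, e n.+1 `<=` e n) -> e 0%N = setT -> e N = set0 ->
  exists xi : T -> nat, [/\ forall w, (1 <= xi w)%N, forall w, (xi w <= N)%N,
    stopping_time Y xi & forall i, e i = [set w | (i < xi w)%N]].
Proof.
move=> Fe ne e0 eN.
have le_e i j : (i <= j)%N -> e j `<=` e i.
  move=> /subnK <-; elim: (j - i)%N => // k IH.
  by rewrite addSn; apply: subset_trans IH; exact: ne.
have ex w : exists n, w \notin e n by exists N; rewrite eN notin_setE.
pose xi w := ex_minn (ex w).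
have xiP i w : (i < xi w)%N <-> e i w.
  rewrite /xi; case: ex_minnP => m /negP em mmin; split.
    move=> im; apply: contrapT => nei.
    have : (m <= i)%N by apply: mmin; rewrite notin_setE.
    by rewrite leqNgt im.
  by move=> ei; rewrite ltnNge; apply/negP => mi; apply/em/mem_set/(le_e _ _ mi).
exists xi; split.
- by move=> w; apply/xiP; rewrite e0.
- by move=> w; rewrite leqNgt; apply/negP => /xiP; rewrite eN.
- move=> n; rewrite (_ : [set w | _] = ~` e n).
    exact: sigma_algebraC (Fe n).
  apply/seteqP; split => w /=; first by rewrite leqNgt => /negP nx /xiP.
  by move=> nx; rewrite leqNgt; apply/negP => /xiP.
- by move=> i; apply/seteqP; split => w /xiP.
Qed.

End stopping_of_events.

(** * Comparison of Gittins indices *)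

Section comparison.
Context (R : realType) (s2 beta : R).
Hypotheses (s0 : (0 < s2)%R) (beta0 : (0 < beta)%R) (beta1 : (beta < 1)%R).

Section one_process.
Context (u v : R) (M : normal_reward_process u v s2).
Hypothesis v0 : (0 < v)%R.
Local Notation P := (Pr M).
Local Notation Y := (reward M).

Lemma Rintegral_value r N :
  (\int[P]_w value_after beta r N 0 w = value beta s2 r N v u)%R.
Proof.
rewrite (_ : value_after _ _ _ _ = cst (value beta s2 r N v u))//.
rewrite Rintegral_cst//.
by apply: etrans (congr1 (fun z => _ * fine z)%R (probability_setT P)) (mulr1 _).
Qed.

Lemma payoff_le_value r xi N : (forall w, (1 <= xi w)%N) -> stopping_time Y xi ->
  (\int[P]_w payoff beta r xi N w <= value beta s2 r N v u)%R.
Proof.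
move=> xi1 st; rewrite Rintegral_payoff// -Rintegral_value.
have := @value_upper _ _ _ _ _ M v0 s0 (ltW beta0) r (going_on xi)
  (fun i => @going_on_filtration _ _ _ _ M xi i st) _ N 0%N.
rewrite (_ : going_on xi 0 = setT); last by rewrite -subTset => w _; exact: xi1.
by apply => n w; exact: ltnW.
Qed.

Lemma value_attained r N : (0 < N)%N -> exists xi, [/\ forall w, (1 <= xi w)%N,
  stopping_time Y xi &
  (\int[P]_w net_reward beta r xi w = value beta s2 r N v u)%R].
Proof.
move=> N0.
have oN := optimal_rule_horizon beta M r N0.
have [|xi [xi1 xiN st xiE]] := @stopping_time_of_events _ _ _ Y
  (optimal_rule beta r N) N (@optimal_rule_filtration _ _ _ _ _ M v0 s0 (ltW beta0) r N)
  _ erefl oN.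
  by move=> n; exact: subIsetl.
exists xi; split => //.
transitivity (\int[P]_w payoff beta r xi N w)%R.
  by apply: eq_Rintegral => w _; rewrite payoff_stopped.
rewrite Rintegral_payoff// -Rintegral_value.
rewrite -(@optimal_rule_value _ _ _ _ _ M v0 s0 (ltW beta0) r N N 0 (addn0 N)).
by apply: eq_bigr => i _; rewrite add0n xiE.
Qed.

Lemma expected_net_reward xi : stopping_time Y xi -> (forall w, (1 <= xi w)%N) ->
  exists a b : R, [/\ 'E_P[discounted_reward beta xi] = a%:E,
    'E_P[discounted_time beta xi] = b%:E, (1 <= b)%R &
    forall r, (\int[P]_w net_reward beta r xi w = a - r * b)%R].
Proof.
move=> st xi1.
have [i0 _] := net_reward_limit v0 s0 beta0 beta1 0%R st.
have [i1 _] := net_reward_limit v0 s0 beta0 beta1 1%R st.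
have iR : P.-integrable setT (EFin \o discounted_reward beta xi).
  by apply: eq_integrable i0 => // w _; rewrite /= /net_reward mul0r subr0.
have iT : P.-integrable setT (EFin \o discounted_time beta xi).
  apply: eq_integrable (integrableB measurableT i0 i1) => // w _ /=.
  by rewrite -EFinB; congr EFin; rewrite /net_reward; ring.
exists (\int[P]_w discounted_reward beta xi w)%R, (\int[P]_w discounted_time beta xi w)%R.
split.
- by rewrite unlock /Rintegral fineK//; exact: (integrable_fin_num measurableT iR).
- by rewrite unlock /Rintegral fineK//; exact: (integrable_fin_num measurableT iT).
- have i1' : P.-integrable setT (EFin \o cst (1%R : R)).
    exact: finite_measure_integrable_cst.
  have P1 : fine (P setT) = 1%R.
    by apply: etrans (congr1 fine (probability_setT P)) _.
  have := le_Rintegral measurableT i1' iT; rewrite Rintegral_cst// mul1r P1; apply.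
  move=> w _; rewrite /discounted_time -(prednK (xi1 w)) big_nat_recl// expr0.
  by rewrite lerDl sumr_ge0// => i _; rewrite exprn_ge0// ltW.
move=> r.
have irT : P.-integrable setT (EFin \o (fun w => r * discounted_time beta xi w)%R).
  exact: (integrableZl measurableT r iT).
by rewrite -(RintegralZl r measurableT iT) -(RintegralB measurableT iR irT).
Qed.

End one_process.

(** Charge each step of [M] the ratio [rho] achieved by a stopping time [xi], so
    that [xi] breaks even. Truncated at a large [N] it loses at most [eps], so the
    value of [M] is at least [- eps], hence also that of [M'] at the charge
    [rho + d]. An optimal stopping time of [M'] attains that value, and it pays at
    least [rho + d - eps] per step, as its expected discounted time is at least
    [1]. *)
Lemma le_gittins_index (d u v v' : R) (M : normal_reward_process u v s2)
    (M' : normal_reward_process (u + d)%R v' s2) :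
  (0 < v)%R -> (v <= v')%R ->
  d%:E + gittins_index M beta <= gittins_index M' beta.
Proof.
move=> v0 vv'; have v'0 : (0 < v')%R by exact: lt_le_trans vv'.
rewrite addeC -leeBrDr//; apply: ge_ereal_sup => _ [xi [xi1 st] <-].
have [a [b [aE bE b1 netE]]] := expected_net_reward v0 st xi1.
have b0 : (0 < b)%R by exact: lt_le_trans b1.
rewrite aE bE inver gt_eqF// -EFinM leeBrDr// -EFinD.
set rho := (a / b)%R.
apply/lee_subgt0Pr => eps eps0.
have [_ cv] := net_reward_limit v0 s0 beta0 beta1 rho st.
have net0 : (\int[Pr M]_w net_reward beta rho xi w = 0)%R.
  by rewrite netE /rho divfK ?subrr// gt_eqF.
rewrite net0 in cv.
have [N N0 payN] : exists2 N, (0 < N)%N &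
    (- eps <= \int[Pr M]_w payoff beta rho xi N w)%R.
  have [K _ HK] : \forall n \near \oo,
      (- eps <= \int[Pr M]_w payoff beta rho xi n w)%R.
    by apply: (cvgr_ge _ cv); rewrite oppr_lt0.
  by exists K.+1 => //; apply: HK => /=.
have [xi' [xi'1 st' xi'E]] := value_attained M' v'0 (rho + d)%R N0.
have [a' [b' [a'E b'E b'1 net'E]]] := expected_net_reward v'0 st' xi'1.
have b'0 : (0 < b')%R by exact: lt_le_trans b'1.
have key : (- eps <= a' - (rho + d) * b')%R.
  rewrite -net'E xi'E (le_trans payN)// (le_trans (payoff_le_value v0 rho N xi1 st))//.
  by apply: le_value => //; exact: ltW.
apply: (@le_trans _ _ (a' / b')%:E).
  rewrite -EFinB lee_fin ler_pdivlMr//.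
  have : (eps <= eps * b')%R by rewrite ler_peMr// ltW.
  by lra.
apply: ereal_sup_ubound; exists xi' => //.
by rewrite a'E b'E inver gt_eqF.
Qed.

End comparison.

Local Close Scope ereal_scope.
Unset Implicit Arguments.

Theorem corollary1 (R : realType) (s2 beta : R) (hs2 : 0 < s2)
    (hbeta0 : 0 < beta) (hbeta1 : beta < 1) :
  (forall (u v : R), 0 < v ->
    forall (M : normal_reward_process u v s2)
           (M0 : normal_reward_process 0 v s2),
    gittins_index M beta = (u%:E + gittins_index M0 beta)%E) /\
  (forall (v u u' : R), 0 < v -> u <= u' ->
    forall (M : normal_reward_process u v s2)
           (M' : normal_reward_process u' v s2),
    (gittins_index M beta <= gittins_index M' beta)%E) /\
  (forall (u v v' : R), 0 < v -> v <= v' ->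
    forall (M : normal_reward_process u v s2)
           (M' : normal_reward_process u v' s2),
    (gittins_index M beta <= gittins_index M' beta)%E).
Proof.
have le_index d u u' v v' (M : normal_reward_process u v s2)
    (M' : normal_reward_process u' v' s2) : u' = u + d ->
    0 < v -> v <= v' ->
    (d%:E + gittins_index M beta <= gittins_index M' beta)%E.
  by move=> u'E; move: M'; rewrite u'E => M'; exact: le_gittins_index.
split; [|split].
- move=> u v v0 M M0; apply/eqP; rewrite eq_le; apply/andP; split; last first.
    by apply: le_index => //; rewrite add0r.
  rewrite addeC -leeBlDr// addeC -EFinN.
  by apply: le_index => //; rewrite subrr.
- move=> v u u' v0 uu' M M'.
  apply: (@le_trans _ _ ((u' - u)%:E + gittins_index M beta)%E).
    by rewrite leeDr// lee_fin subr_ge0.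
  by apply: le_index => //; rewrite addrC subrK.
- move=> u v v' v0 vv' M M'.
  have := @le_index 0 u u v v' M M'; rewrite add0e; apply => //.
  by rewrite addr0.
Qed.
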